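(* Let $A$ be an invertible inertia operator on vector fields on $\mathbb{R}^n$ that preserves radial vector fields. Let $u_0$ be radial initial data such that $\omega_0$, defined by $A(u_0(r)\partial_r)=\omega_0(r)\partial_r$, satisfies $\omega_0(r)\le 0$ for all $r>0$. Let the solution $u$ of $A(u(r)\partial_r)=\omega(r)\partial_r$ be given by an integral formula of the form $$u(r)=\int_0^r\delta(s,r)\,s^{n-1}\omega(s)\,ds+\int_r^\infty\delta(r,s)\,s^{n-1}\omega(s)\,ds,$$ for a kernel $\delta$ that is smooth and positive on $D=\{(r,s)\mid s\ge r\ge 0\}\setminus\{(0,0)\}$. Suppose there exist a differentiable function $Q:[0,\infty)\to(0,\infty)$ and a constant $C>0$ such that, for all pairs for which the arguments of $\delta$ lie in $D$, $$\frac{Q'(r)}{Q(r)}\,\delta(s,r)+\partial_2\delta(s,r)\ge 0\quad\text{for all } s\in[0,r),$$ $$\frac{Q'(r)}{Q(r)}\,\delta(r,s)+\partial_1\delta(r,s)\ge\frac{C}{Q(s)}\quad\text{for all } s\in[r,\infty).$$ Assume in addition that there exists a local solution $(\gamma,\rho)$, corresponding to the initial condition $u_0$ (with $\gamma(0,r)=r$, $\rho(0,r)=1$), of the system $$\frac{d\gamma}{dt}(r)=\int_0^r\frac{\delta(\gamma(s),\gamma(r))}{\rho(s)}z_0(s)\,ds+\int_r^\infty\frac{\delta(\gamma(r),\gamma(s))}{\rho(s)}z_0(s)\,ds,$$ $$\frac{d\rho}{dt}(r)=\rho(r)\int_0^r\frac{\partial_2\delta(\gamma(s),\gamma(r))}{\rho(s)}z_0(s)\,ds+\rho(r)\int_r^\infty\frac{\partial_1\delta(\gamma(r),\gamma(s))}{\rho(s)}z_0(s)\,ds,$$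 where $z_0(r)=r^{n-1}\omega_0(r)$. Then the solution $\rho(t,r)=\gamma_r(t,r)$ reaches zero in finite time $T$ (for some $r\ge0$), and thus the $C^1$ norm of $u(t,\cdot)$, where $u$ is the solution of the radial EPDiff equation with initial data $u_0$, blows up at time $T$, in the sense that $u$ cannot be extended as a $C^1$ solution to time $T$.
   Context: A radial vector field on $\mathbb{R}^n$ is one of the form $u(r)\partial_r$ with $r=|x|$. The EPDiff equation with inertia operator $A$ (an $L^2$-symmetric, positive-definite linear operator) is $\Omega_t+\nabla_U\Omega+(\nabla U)^T\Omega+\operatorname{div}(U)\Omega=0$, $\Omega=AU$. For radial fields $U=u(t,r)\partial_r$ with $AU=\omega(t,r)\partial_r$ it becomes the radial EPDiff equation $$\omega_t+u\,\omega_r+2u_r\,\omega+\frac{n-1}{r}\,u\,\omega=0 .$$ The radial Lagrangian flow $\gamma$ is defined by $\gamma_t(t,r)=u(t,\gamma(t,r))$, $\gamma(0,r)=r$. In the system for $(\gamma,\rho)$ the dependence on $t$ is suppressed, and $\partial_1\delta,\partial_2\delta$ denote the partial derivatives of $\delta$ in its first and second arguments. The system is viewed as a single ODE for $\rho$ on the space $$\mathcal{P}=\{\rho\in C([0,\infty),\mathbb{R}^+)\mid \exists\, b\ge a>0 \text{ such that } \rho(r)\in[a,b]\ \forall r\ge0\},$$ where $\gamma$ is the antiderivative of $\rho$ in $r$ with $\gamma(0)=0$ (so $\rho=\gamma_r$). It is obtained from the radial EPDiff equation through the conservation law $\gamma^{n-1}\gamma_r^2\,\omega(t,\gamma)=r^{n-1}\omega_0(r)$;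 $u$ is recovered from $\gamma$ by $u(t,\gamma(t,r))=\gamma_t(t,r)$. A classical solution $u$ exists on $[0,T)$ so long as $u(t,\cdot)$ is $C^1$ on $r\ge0$ for each $t\in[0,T)$.
   Formalization: Added: u_0 is not identically zero, and the solution of the system continues past any finite time as long as, at each fixed r, ρ(t,r) stays bounded below by a positive constant. Positivity of δ is required only for 0<r≤s. *)

(* Defs.v *)
(* MathComp-Analysis; the reals are an arbitrary R : realType. *)
From mathcomp Require Import all_boot all_order all_algebra.
From mathcomp Require Import all_classical all_reals all_analysis.

Set Implicit Arguments.
Unset Strict Implicit.
Unset Printing Implicit Defensive.

Import Order.TTheory GRing.Theory Num.Theory numFieldNormedType.Exports.

Local Open Scope classical_set_scope.
Local Open Scope ring_scope.

Definition vfield (R : realType) (n : nat) : Type := 'rV[R]_n -> 'rV[R]_n.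

Definition dot (R : realType) (n : nat) (x y : 'rV[R]_n) : R :=
  \sum_(i < n) x 0 i * y 0 i.

(* The library norm on row vectors is the sup norm, so |x| is defined here. *)
Definition enorm (R : realType) (n : nat) (x : 'rV[R]_n) : R :=
  Num.sqrt (dot x x).

(* The field u(|x|) d/dr. Since y / 0 = 0, its value at the origin is 0, so
   u is determined by its field only on r > 0. *)
Definition radial (R : realType) (n : nat) (u : R -> R) : vfield R n :=
  fun x => (u (enorm x) / enorm x) *: x.

(* Lebesgue integration over R^n, written as an iterated integral over the
   coordinates. It is only applied to functions satisfying [Rn_integrable],
   where Fubini's theorem identifies it with the n-dimensional integral. *)
Fixpoint Rn_integral (R : realType) (n : nat) :
    (n.-tuple R -> \bar R) -> \bar R :=
  match n with
  | 0 => fun f => f [tuple]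
  | m.+1 => fun f =>
      (\int[@lebesgue_measure R]_x
         Rn_integral (fun t : m.-tuple R => f [tuple of x :: t]))%E
  end.

Definition Rn_integrable (R : realType) (n : nat) (f : n.-tuple R -> R) : Prop :=
  measurable_fun setT (f : n.-tuple (measurableTypeR R) -> measurableTypeR R) /\
  (Rn_integral (fun t => `|f t|%:E) < +oo)%E.

Definition L2_density (R : realType) (n : nat) (U V : vfield R n)
    (t : n.-tuple R) : R :=
  dot (U (\row_i tnth t i)) (V (\row_i tnth t i)).

Definition L2_pairing (R : realType) (n : nat) (U V : vfield R n) : \bar R :=
  Rn_integral (fun t => (L2_density U V t)%:E).

(* An inertia operator with domain E and range F. Only the values of A on the
   space E are meaningful. *)
Record invertible_inertia_operator (R : realType) (n : nat)
    (E F : set (vfield R n)) (A : vfield R n -> vfield R n) : Prop := {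
  inertia_dom0 : E (fun=> 0);
  inertia_domD : forall (a : R) (U V : vfield R n),
    E U -> E V -> E (fun x => a *: U x + V x);
  inertia_linear : forall (a : R) (U V : vfield R n),
    E U -> E V -> A (fun x => a *: U x + V x) = (fun x => a *: A U x + A V x);
  inertia_integrable : forall U V : vfield R n,
    E U -> E V -> Rn_integrable (L2_density (A U) V);
  inertia_symmetric : forall U V : vfield R n,
    E U -> E V -> L2_pairing (A U) V = L2_pairing U (A V);
  inertia_posdef : forall U : vfield R n,
    E U -> U <> (fun=> 0) -> (0 < L2_pairing (A U) U)%E;
  inertia_invertible : set_bij E F A
}.

Definition preserves_radial (R : realType) (n : nat) (E : set (vfield R n))
    (A : vfield R n -> vfield R n) : Prop :=
  forall u : R -> R, E (radial u) ->
    exists omega : R -> R, A (radial u) = radial omega.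

(* Derivative of f at x along D; one-sided when x is an endpoint of D. *)
Definition has_deriv_within (R : realType) (D : set R) (f : R -> R)
    (x l : R) : Prop :=
  (f y - f x) / (y - x) @[y --> within D x^'] --> l.

Definition partial1 (R : realType) (f : R -> R -> R) : R -> R -> R :=
  fun r s => derive1 (f^~ s) r.

Definition partial2 (R : realType) (f : R -> R -> R) : R -> R -> R :=
  fun r s => derive1 (f r) s.

(* Iterated partial derivative along a word: true for the first variable. *)
Definition partials (R : realType) (w : seq bool) (f : R -> R -> R) :
    R -> R -> R :=
  foldr (fun b g => if b then partial1 g else partial2 g) f w.

(* Smoothness on an arbitrary subset of the plane means smoothness on an open
   neighbourhood of it, so f stands for such an extension; on the wedge below
   its derivatives do not depend on the extension, the wedge being
   contained in the closure of its interior. *)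
Definition smooth_on (R : realType) (D : set (R * R)) (f : R -> R -> R) : Prop :=
  exists U : set (R * R), [/\ open U, D `<=` U &
    forall (w : seq bool) (p : R * R), U p ->
      [/\ {for p, continuous (fun q : R * R => partials w f q.1 q.2)},
          derivable ((partials w f)^~ p.2) p.1 1 &
          derivable (partials w f p.1) p.2 1]].

Definition wedge (R : realType) : set (R * R) :=
  [set p | 0 <= p.1 <= p.2 /\ p <> (0, 0)].

(* v is the sum of the integrals of f over [0, r] and of g over [r, oo), both
   converging absolutely. *)
Definition is_split_integral (R : realType) (r : R) (f g : R -> R) (v : R) :
    Prop :=
  [/\ (@lebesgue_measure R).-integrable `[0, r] (EFin \o f),
      (@lebesgue_measure R).-integrable `[r, +oo[ (EFin \o g) &
      v = \int[@lebesgue_measure R]_(s in `[0, r]) f s +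
          \int[@lebesgue_measure R]_(s in `[r, +oo[) g s].

Definition kernel_formula (R : realType) (n : nat) (delta : R -> R -> R)
    (omega : R -> R) (r v : R) : Prop :=
  is_split_integral r
    (fun s => delta s r * (s ^+ n.-1 * omega s))
    (fun s => delta r s * (s ^+ n.-1 * omega s)) v.

Definition phase_space (R : realType) : set (R -> R) :=
  [set rho : R -> R | {within `[0, +oo[, continuous rho} /\
    exists a b : R, 0 < a <= b /\ forall r, 0 <= r -> a <= rho r <= b].

(* A solution on [0, T) of the system with z0 = r^(n-1) omega0, as an ordinary
   differential equation for rho on phase_space: t |-> rho t is a C^1 curve for
   the sup norm on [0, oo), with derivative drho. *)
Record system_solution (R : realType) (n : nat) (delta : R -> R -> R)
    (omega0 : R -> R) (T : R) (gamma rho : R -> R -> R) : Prop := {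
  sys_gamma_init : forall r, 0 <= r -> gamma 0 r = r;
  sys_rho_init : forall r, 0 <= r -> rho 0 r = 1;
  sys_phase : forall t, 0 <= t < T -> phase_space (rho t);
  sys_gamma0 : forall t, 0 <= t < T -> gamma t 0 = 0;
  sys_gamma_rho : forall t r, 0 <= t < T -> 0 <= r ->
    has_deriv_within `[0, +oo[ (gamma t) r (rho t r);
  sys_gamma_eq : forall t r, 0 <= t < T -> 0 <= r ->
    exists v : R,
      has_deriv_within `[0, T[ (gamma^~ r) t v /\
      is_split_integral r
        (fun s => delta (gamma t s) (gamma t r) / rho t s *
                  (s ^+ n.-1 * omega0 s))
        (fun s => delta (gamma t r) (gamma t s) / rho t s *
                  (s ^+ n.-1 * omega0 s)) v;
  sys_rho_eq : exists drho : R -> R -> R, forall t, 0 <= t < T ->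
    [/\ {uniform `[0, +oo[, (fun y r => (rho y r - rho t r) / (y - t)) @
           within `[0, T[ t^' --> drho t},
        {uniform `[0, +oo[, drho @ within `[0, T[ (nbhs t) --> drho t} &
        forall r, 0 <= r -> exists w : R,
          drho t r = rho t r * w /\
          is_split_integral r
            (fun s => partial2 delta (gamma t s) (gamma t r) / rho t s *
                      (s ^+ n.-1 * omega0 s))
            (fun s => partial1 delta (gamma t r) (gamma t s) / rho t s *
                      (s ^+ n.-1 * omega0 s)) w]
}.

Definition extends (R : realType) (T : R) (gamma rho gamma' rho' : R -> R -> R) :
    Prop :=
  forall t r, 0 <= t < T -> 0 <= r ->
    gamma' t r = gamma t r /\ rho' t r = rho t r.

(* The solution of the ODE does not stop before rho reaches zero: if at each
   fixed r the values of rho stay away from 0 on [0, T), then it goes on. *)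
Definition continues_while_positive (R : realType) (n : nat)
    (delta : R -> R -> R) (omega0 : R -> R) : Prop :=
  forall (T : R) (gamma rho : R -> R -> R),
    0 < T -> system_solution n delta omega0 T gamma rho ->
    (forall r, 0 <= r -> exists2 c, 0 < c &
       forall t, 0 <= t < T -> c <= rho t r) ->
    exists (T' : R) (gamma' rho' : R -> R -> R),
      [/\ T < T', system_solution n delta omega0 T' gamma' rho' &
          extends T gamma rho gamma' rho'].

(* Here u is only C^1 in r, so omega need not be differentiable in r: the
   transport part omega_t + u omega_r of
     omega_t + u omega_r + 2 u_r omega + (n - 1) / r u omega = 0
   is the derivative of omega along the trajectories of the flow gamma of u.
   The momentum omega(t) and the velocity u(t) are related by the integral
   formula that inverts the inertia operator. *)
Record radial_EPDiff_solution (R : realType) (n : nat) (delta : R -> R -> R)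
    (u0 omega0 : R -> R) (J : set R) (u du omega gamma : R -> R -> R) : Prop := {
  epd_u_cont : {within J `*` `[0, +oo[, continuous (fun p : R * R => u p.1 p.2)};
  epd_du_cont :
    {within J `*` `[0, +oo[, continuous (fun p : R * R => du p.1 p.2)};
  epd_du : forall t r, J t -> 0 <= r ->
    has_deriv_within `[0, +oo[ (u t) r (du t r);
  epd_u_init : forall r, 0 < r -> u 0 r = u0 r;
  epd_omega_init : forall r, 0 < r -> omega 0 r = omega0 r;
  epd_momentum : forall t r, J t -> 0 < r ->
    kernel_formula n delta (omega t) r (u t r);
  epd_flow_init : forall r, 0 <= r -> gamma 0 r = r;
  epd_flow_ge0 : forall t r, J t -> 0 <= r -> 0 <= gamma t r;
  epd_flow : forall t r, J t -> 0 <= r ->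
    has_deriv_within J (gamma^~ r) t (u t (gamma t r));
  epd_equation : forall t r, J t -> 0 < r ->
    has_deriv_within J (fun y => omega y (gamma y r)) t
      (- (2 * du t (gamma t r) * omega t (gamma t r) +
          n.-1%:R / gamma t r * u t (gamma t r) * omega t (gamma t r)))
}.

Definition C1_solution (R : realType) (n : nat) (delta : R -> R -> R)
    (u0 omega0 : R -> R) (J : set R) (u : R -> R -> R) : Prop :=
  exists du omega gamma : R -> R -> R,
    radial_EPDiff_solution n delta u0 omega0 J u du omega gamma.

(* limsup of the C^1 norm of u(t) as t increases to T is infinite. *)
Definition C1_norm_blows_up (R : realType) (T : R) (u : R -> R -> R) : Prop :=
  forall M t0 : R, t0 < T -> exists t r d : R,
    [/\ t0 < t < T /\ 0 <= t, 0 <= r,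
        has_deriv_within `[0, +oo[ (u t) r d & M < `|u t r| + `|d|].

(* Main.v *)
Require Import Defs.
From HB Require Import structures.
From mathcomp Require Import all_boot all_order all_algebra.
From mathcomp Require Import all_classical all_reals all_analysis.
From mathcomp Require Import measurable_realfun ring lra.

Set Implicit Arguments.
Unset Strict Implicit.
Unset Printing Implicit Defensive.

Import Order.TTheory GRing.Theory Num.Theory numFieldNormedType.Exports.

Local Open Scope classical_set_scope.
Local Open Scope ring_scope.

(** Why the solution breaks down. Write z0(s) = s^(n-1) omega0(s), which is
nonpositive, and w = 1 / (Q(gamma) rho).

Along the system the logarithmic derivative of Q(gamma) rho is
(Q'/Q)(gamma) gamma_t + rho_t / rho. Inserting the two integrals of the system,
delta and its derivatives occur only in the combinations bounded by the two
hypotheses on Q. As z0 <= 0, the integral over [0, r] is nonpositive and can be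
dropped, and the integral over [r, oo) leaves
  w_t >= C w F,   where F(t, r) is the integral of |z0| w(t, .) over [r, oo)
([growth_rate_le], [weight_growth]). So w and F are nondecreasing in time.
Since F_r = - |z0| w, the integral of |z0| w F over the half-line is F(t, 0)^2 / 2
([sqr_integral_le_tail]), and integrating the inequality for w gives
  F(t, 0) >= F(t', 0) + (C / 2) (t - t') F(t', 0)^2     ([mass_step]).
This difference form of the Riccati inequality F_t >= (C / 2) F^2 needs no
differentiation under the integral sign, and already bounds every lifetime by
4 / (C F(0, 0)) ([riccati_blowup]). The value F(0, 0) depends on omega0 and Q only,
and it is positive because u0, an integral against z0, is not zero
([momentum_density_neq0]). Hence all solutions of the system have lifetimes below
a common bound.

By Zorn's lemma the local solution then has a maximal extension, on some [0, T)
([maximal_solution_exists]). It does not go on, so at some r the values of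
rho(., r) are not bounded away from zero. Now gamma(., r) is nonincreasing,
because the velocity is nonpositive, and so is Q(gamma) rho = 1 / w. Since
Q(gamma) stays between two positive constants, rho(t, r) tends to zero
([stretch_vanishes]).

The velocity is u = gamma_t o gamma^-1, and u_r = (rho_t / rho) o gamma^-1. Both
are jointly continuous because t |-> rho is C^1 for the sup norm
([velocity_continuous], [velocity_gradient_continuous]). The conservation law
gamma^(n-1) rho^2 omega(t, gamma) = z0 defines omega, and the substitution
s = gamma(t, sigma) turns the equation for gamma_t into the integral formula
that relates u to omega ([transported_momentum_kernel]). So u is a C^1 solution
on [0, T). At the r found above log rho tends to - oo in finite time, so its
derivative u_r along the trajectory of r is unbounded
([velocity_gradient_unbounded]). The trajectory converges, so u_r would be
bounded along it if u were C^1 up to time T ([velocity_not_extendable]). *)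

(** * One-sided derivatives *)

Section derivatives_within.
Context {R : realType}.
Implicit Types (D : set R) (f g : R -> R) (x l : R).

Lemma has_deriv_withinP D f x l : has_deriv_within D f x l <->
  forall e : R, 0 < e -> exists2 d : R, 0 < d & forall y, D y -> `|y - x| < d ->
    `|f y - f x - l * (y - x)| <= e * `|y - x|.
Proof.
split.
- move=> /cvgrPdist_le H e e0; have [d/= d0 Hd] := H _ e0.
  exists d => // y Dy yx; have [->|ynx] := eqVneq y x.
    by rewrite !subrr mulr0 subr0 normr0 mulr0.
  have := Hd y; rewrite /= distrC => /(_ yx ynx Dy) {}Hd.
  have yx0 : y - x != 0 by rewrite subr_eq0.
  by rewrite -ler_pdivrMr ?normr_gt0// -normf_div mulrBl mulfK// distrC.
- move=> H; apply/cvgrPdist_le => e e0; have [d d0 Hd] := H _ e0.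
  exists d => //= y yx ynx Dy; have yx0 : y - x != 0 by rewrite subr_eq0.
  have := Hd y Dy; rewrite distrC => /(_ yx).
  rewrite (distrC x) -ler_pdivrMr ?normr_gt0// -normf_div mulrBl mulfK//.
  by rewrite distrC.
Qed.

(** Caratheodory's form of the derivative. The slope q is defined at x as well, so
    the product and chain rules reduce to limits of products and composites. *)
Lemma has_deriv_within_slope D f x l : has_deriv_within D f x l <->
  exists q : R -> R, [/\ q x = l, forall y, f y - f x = q y * (y - x) &
    q @ within D (nbhs x) --> l].
Proof.
split.
- move=> H; exists (fun y => if y == x then l else (f y - f x) / (y - x)).
  split; first by rewrite eqxx.
    move=> y; case: eqVneq => [->|yx]; first by rewrite !subrr mulr0.
    by rewrite mulfVK// subr_eq0.
  apply/cvgrPdist_le => e e0; move/cvgrPdist_le : H => /(_ _ e0) [d/= d0 Hd].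
  exists d => //= y xy Dy; case: eqVneq => [_|ynx].
    by rewrite subrr normr0 ltW.
  exact: Hd.
- move=> [q [qx fq qc]]; apply/cvgrPdist_le => e e0.
  move/cvgrPdist_le : qc => /(_ _ e0) [d/= d0 Hd].
  exists d => //= y xy ynx Dy.
  by rewrite fq mulfK ?subr_eq0//; exact: Hd.
Qed.

Lemma has_deriv_within_cont D f x l : has_deriv_within D f x l ->
  f @ within D (nbhs x) --> f x.
Proof.
move=> /has_deriv_within_slope[q [_ fq qc]].
have -> : f = (fun y => f x + q y * (y - x)).
  by apply/funext => y; rewrite -fq addrC subrK.
rewrite subrr mulr0 addr0 -[X in _ --> X]addr0 -(mulr0 l).
apply: cvgD; first exact: cvg_cst.
apply: cvgM => //; rewrite -(subrr x); apply: cvgB; last exact: cvg_cst.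
exact: cvg_within.
Qed.

Lemma has_deriv_within_subset D D' f x l : D' `<=` D ->
  has_deriv_within D f x l -> has_deriv_within D' f x l.
Proof.
by move=> sD; apply: cvg_trans; apply: cvg_app => A [d /= d0 Ad];
  exists d => //= y yx ynx /sD; exact: Ad.
Qed.

Lemma has_deriv_within_eq D f g x l : D x -> {in D, f =1 g} ->
  has_deriv_within D f x l -> has_deriv_within D g x l.
Proof.
move=> Dx fg /has_deriv_withinP H; apply/has_deriv_withinP => e /H[d d0 Hd].
by exists d => // y Dy; rewrite -!fg ?inE//; exact: Hd.
Qed.

Lemma has_deriv_within_unique D f x l l' :
  (forall d : R, 0 < d -> exists2 y, D y & 0 < `|y - x| < d) ->
  has_deriv_within D f x l -> has_deriv_within D f x l' -> l = l'.
Proof.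
move=> acc /has_deriv_withinP H /has_deriv_withinP H'.
apply/eqP; rewrite -subr_eq0 -normr_le0; apply/ler_addgt0Pl => e e0.
have e20 : 0 < e / 2 by rewrite divr_gt0.
have [d d0 Hd] := H _ e20; have [d' d'0 Hd'] := H' _ e20.
have [|y Dy /andP[y0 yd]] := acc (Num.min d d'); first by rewrite lt_min d0.
move: yd; rewrite lt_min => /andP[yd yd'].
have {}Hd := Hd _ Dy yd; have {}Hd' := Hd' _ Dy yd'.
rewrite addr0 -(ler_pM2r y0) -normrM.
rewrite (_ : _ * _ = (f y - f x - l' * (y - x)) - (f y - f x - l * (y - x))).
  apply: (le_trans (ler_normB _ _)); apply: (le_trans (lerD Hd' Hd)).
  by rewrite -mulrDl -splitr.
by ring.
Qed.

Lemma has_deriv_within_cst D c x : has_deriv_within D (fun=> c) x 0.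
Proof.
by apply/has_deriv_within_slope; exists (fun=> 0); split => //;
  [move=> y; rewrite subrr mul0r|exact: cvg_cst].
Qed.

Lemma has_deriv_withinM D f g x l m :
  has_deriv_within D f x l -> has_deriv_within D g x m ->
  has_deriv_within D (fun y => f y * g y) x (l * g x + f x * m).
Proof.
move=> fx gx; have gc := has_deriv_within_cont gx.
move: fx gx => /has_deriv_within_slope[p [px fp pc]].
move=> /has_deriv_within_slope[q [qx gq qc]].
apply/has_deriv_within_slope; exists (fun y => p y * g y + f x * q y); split.
- by rewrite px qx.
- move=> y; have := fp y; have := gq y.
  rewrite mulrDl -!mulrA (mulrC (g y)) !mulrA -fp -mulrA -gq => _ _; ring.
- apply: cvgD; first exact: cvgM.
  by apply: cvgM => //; exact: cvg_cst.
Qed.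

Lemma has_deriv_withinB D f g x l m :
  has_deriv_within D f x l -> has_deriv_within D g x m ->
  has_deriv_within D (fun y => f y - g y) x (l - m).
Proof.
move=> /has_deriv_within_slope[p [px fp pc]].
move=> /has_deriv_within_slope[q [qx gq qc]].
apply/has_deriv_within_slope; exists (fun y => p y - q y); split.
- by rewrite px qx.
- by move=> y; have := fp y; have := gq y; rewrite mulrBl => <- <-; ring.
- exact: cvgB.
Qed.

Lemma has_deriv_within_comp D D' f g x l m : (forall y, D y -> D' (f y)) ->
  has_deriv_within D f x l -> has_deriv_within D' g (f x) m ->
  has_deriv_within D (fun y => g (f y)) x (m * l).
Proof.
move=> DD' fx gx; have fc := has_deriv_within_cont fx.
move: fx gx => /has_deriv_within_slope[p [px fp pc]].
move=> /has_deriv_within_slope[q [qx gq qc]].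
apply/has_deriv_within_slope; exists (fun y => q (f y) * p y); split.
- by rewrite px qx.
- by move=> y; rewrite gq fp mulrA.
- apply: cvgM => //; apply: cvg_comp qc => A [d/= d0 Ad].
  move/cvgrPdist_lt : fc => /(_ _ d0)[e/= e0 He].
  by exists e => //= y yx Dy; apply: Ad => /=; [exact: He|exact: DD'].
Qed.

Lemma is_derive_has_deriv_within D f x l :
  is_derive x (1 : R) f l -> has_deriv_within D f x l.
Proof.
move=> [df dfl]; apply/has_deriv_withinP => e e0.
move: df; rewrite /derivable => /cvg_ex[k /[dup] hk].
move=> /(cvg_lim (@Rhausdorff R)); rewrite -/(derive f x 1) dfl => lk.
move: hk; rewrite -{}lk => /cvgrPdist_le /(_ _ e0)[d/= d0 Hd].
exists d => // y _ yx; have [->|ynx] := eqVneq y x.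
  by rewrite !subrr mulr0 subr0 normr0 mulr0.
have yx0 : y - x != 0 by rewrite subr_eq0.
have := Hd (y - x); rewrite /= sub0r normrN => /(_ yx yx0).
have -> : (y - x)%:A = y - x :> R by exact: mulr1.
rewrite subrK /GRing.scale/= => {}Hd.
rewrite -ler_pdivrMr ?normr_gt0// -normf_div mulrBl mulfK// distrC.
by rewrite mulrC.
Qed.

Lemma has_deriv_within_is_derive D f x l : nbhs x D ->
  has_deriv_within D f x l -> is_derive x (1 : R) f l.
Proof.
move=> Dx /has_deriv_withinP H.
have key : (fun h => h^-1 *: ((f \o shift x) (h *: (1 : R)) - f x)) @ 0^' --> l.
  apply/cvgrPdist_le => e e0; have [d d0 Hd] := H _ e0.
  have [c /= c0 Hc] := Dx.
  exists (Num.min c d) => /=; first by rewrite lt_min c0.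
  move=> h/=; rewrite sub0r normrN lt_min => /andP[hc hd] h0.
  have := Hd (h + x); rewrite addrK => /(_ _ hd); rewrite [h *: _]mulr1.
  have /Hc Dhx : `|x - (h + x)| < c by rewrite opprD addrC addrNK normrN.
  move=> /(_ Dhx) {}Hd.
  rewrite distrC -(ler_pM2r (_ : 0 < `|h|)) ?normr_gt0// -normrM.
  by rewrite mulrBl [_ *: _]mulrC mulfVK.
by apply: DeriveDef; [apply/cvg_ex; exists l|exact: cvg_lim key].
Qed.

Lemma has_deriv_withinV D f x l : f x != 0 ->
  has_deriv_within D f x l ->
  has_deriv_within D (fun y => (f y)^-1) x (- l / f x ^+ 2).
Proof.
move=> fx0 fx; have : is_derive (f x) (1 : R) (fun y : R => y^-1) (- (f x) ^- 2).
  have := @is_deriveV R id (f x) 1 1 fx0 (is_derive_id _ _).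
  by rewrite /GRing.scale/= mulr1.
move=> /(is_derive_has_deriv_within setT)/(has_deriv_within_comp _ fx).
by rewrite mulNr mulrC mulNr; exact.
Qed.

Lemma has_deriv_withinX D f x l k :
  has_deriv_within D f x l ->
  has_deriv_within D (fun y => f y ^+ k) x (k%:R * f x ^+ k.-1 * l).
Proof.
move=> fx; have : is_derive (f x) (1 : R) (fun y : R => y ^+ k) (k%:R * f x ^+ k.-1).
  have := @is_deriveX R R id k (f x) 1 1 (is_derive_id _ _).
  by rewrite exprfctE /GRing.scale/= mulr1.
by move=> /(is_derive_has_deriv_within setT)/(has_deriv_within_comp _ fx); exact.
Qed.

(** In the interior of the segment the derivative within D is two-sided, and at
    its ends it gives the continuity that the mean value theorem asks for. *)
Lemma mean_value_within D f df (a b : R) : `[a, b] `<=` D -> a <= b ->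
  (forall x, a <= x <= b -> has_deriv_within D f x (df x)) ->
  exists2 c, a <= c <= b & f b - f a = df c * (b - a).
Proof.
move=> abD ab H.
have [| |c + ->] := @MVT_segment R f df a b ab.
- move=> x xab; apply: (@has_deriv_within_is_derive `[a, b]).
    apply: filterS (near_in_itvoo xab) => y yab.
    by rewrite /= in_itv/= !ltW ?(itvP yab).
  by apply: has_deriv_within_subset (H _ _) => //; rewrite !ltW ?(itvP xab).
- apply/subspace_continuousP => x /=; rewrite in_itv/= => /H.
  by move=> /(has_deriv_within_subset abD)/has_deriv_within_cont.
- by rewrite in_itv/= => cab; exists c.
Qed.

End derivatives_within.

(** * Uniform and joint convergence *)

Section uniform_and_joint.
Context {R : realType}.

Lemma uniform_cvgP (A : set R) (F : set_system (R -> R)) (f : R -> R) :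
  Filter F -> {uniform A, F --> f} <->
  forall e : R, 0 < e -> \forall h \near F, forall x, A x -> `|f x - h x| < e.
Proof.
move=> FF; split.
- move=> H e e0; apply: H; apply/uniform_nbhs.
  exists [set xy | ball xy.1 e xy.2].
  split; first by rewrite -entourage_ballE; exists e.
  by move=> h /= Hh x Ax; exact: Hh.
- move=> H P /uniform_nbhs[E [+ EP]]; rewrite -entourage_ballE => -[e /= e0 eE].
  apply: filterS (H e e0) => h Hh; apply: EP => x Ax.
  by apply: eE => /=; exact: Hh.
Qed.

Lemma uniform_quotientP (A D : set R) (rho : R -> R -> R) (h : R -> R) (t : R) :
  {uniform A, (fun y r => (rho y r - rho t r) / (y - t)) @ within D t^' --> h}
  <-> forall e : R, 0 < e -> exists2 d : R, 0 < d & forall y, D y -> y != t ->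
    `|y - t| < d -> forall r, A r -> `|h r - (rho y r - rho t r) / (y - t)| < e.
Proof.
rewrite uniform_cvgP; split => H e e0; have := H e e0.
- move=> [d /= d0 Hd]; exists d => // y Dy yt ytd r Ar.
  by apply: Hd => //=; rewrite distrC.
- move=> [d d0 Hd]; exists d => //= y yt ynt Dy r Ar.
  by apply: Hd => //; rewrite distrC.
Qed.

Lemma uniform_quotient_has_deriv (A D : set R) (rho : R -> R -> R) (h : R -> R)
    (t r : R) :
  {uniform A, (fun y r => (rho y r - rho t r) / (y - t)) @ within D t^' --> h} ->
  A r -> has_deriv_within D (rho^~ r) t (h r).
Proof.
move=> /uniform_quotientP H Ar; apply/cvgrPdist_lt => e /H[d d0 Hd].
by exists d => //= y yt ynt Dy; apply: Hd => //; rewrite distrC.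
Qed.

Lemma uniform_within_nbhsP (A D : set R) (h : R -> R -> R) (t : R) :
  {uniform A, h @ within D (nbhs t) --> h t}
  <-> forall e : R, 0 < e -> exists2 d : R, 0 < d & forall y, D y ->
    `|y - t| < d -> forall r, A r -> `|h t r - h y r| < e.
Proof.
rewrite uniform_cvgP; split => H e e0; have := H e e0.
- move=> [d /= d0 Hd]; exists d => // y Dy ytd r Ar.
  by apply: Hd => //=; rewrite distrC.
- move=> [d d0 Hd]; exists d => //= y yt Dy r Ar.
  by apply: Hd => //; rewrite distrC.
Qed.

Lemma within_cvgP (D : set R) (f : R -> R) (x : R) (l : R) :
  f @ within D (nbhs x) --> l <->
  forall e : R, 0 < e -> exists2 d : R, 0 < d & forall y, D y -> `|y - x| < d ->
    `|f y - l| < e.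
Proof.
split => [/cvgrPdist_lt H e e0|H]; first have [d /= d0 Hd] := H _ e0.
  by exists d => // y Dy yx; rewrite distrC; apply: Hd => //=; rewrite distrC.
apply/cvgrPdist_lt => e e0; have [d d0 Hd] := H _ e0.
by exists d => //= y yx Dy; rewrite distrC; apply: Hd => //; rewrite distrC.
Qed.

Lemma joint_cvgP (J P : set R) (F : R -> R -> R) (t r l : R) :
  (fun p : R * R => F p.1 p.2) @ within (J `*` P) (nbhs (t, r)) --> l <->
  forall e : R, 0 < e -> exists2 d : R, 0 < d & forall t' r', J t' -> P r' ->
    `|t' - t| < d -> `|r' - r| < d -> `|F t' r' - l| < e.
Proof.
split => [/cvgrPdist_lt H e e0|H].
  have [[U V]/= [[d d0 Ud] [d' d'0 Vd]] Hd] := H _ e0.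
  exists (Num.min d d'); first by rewrite lt_min d0.
  move=> t' r' Jt Pr; rewrite !lt_min => /andP[td _] /andP[_ rd].
  rewrite distrC; apply: (Hd (t', r')) => //.
  by split => /=; [apply: Ud|apply: Vd]; rewrite /= distrC.
apply/cvgrPdist_lt => e e0; have [d d0 Hd] := H _ e0.
exists (ball t d, ball r d); first by split; exact: nbhsx_ballx.
move=> [t' r']/= [td rd] [Jt Pr]; rewrite distrC.
by apply: Hd => //; rewrite distrC.
Qed.

Lemma joint_continuousP (J P : set R) (F : R -> R -> R) :
  {within J `*` P, continuous (fun p : R * R => F p.1 p.2)} <->
  forall t r, J t -> P r ->
    (fun p : R * R => F p.1 p.2) @ within (J `*` P) (nbhs (t, r)) --> F t r.
Proof.
split => [/subspace_continuousP H t r Jt Pr|H]; first exact: (H (t, r)).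
by apply/subspace_continuousP => -[t r] [Jt Pr]; exact: H.
Qed.

Lemma joint_cvg_comp (J P P' : set R) (F eta : R -> R -> R) (t x : R) :
  (forall t x, J t -> P x -> P' (eta t x)) ->
  (fun p : R * R => F p.1 p.2) @ within (J `*` P') (nbhs (t, eta t x))
    --> F t (eta t x) ->
  (fun p : R * R => eta p.1 p.2) @ within (J `*` P) (nbhs (t, x)) --> eta t x ->
  (fun p : R * R => F p.1 (eta p.1 p.2)) @ within (J `*` P) (nbhs (t, x))
    --> F t (eta t x).
Proof.
move=> PP' /joint_cvgP HF /joint_cvgP He.
apply/(@joint_cvgP J P (fun t x => F t (eta t x))) => e /HF[d d0 Hd].
have [d' d'0 Hd'] := He _ d0.
exists (Num.min d d'); first by rewrite lt_min d0.
move=> t' r' Jt Pr; rewrite !lt_min => /andP[td td'] /andP[rd rd'].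
by apply: Hd => //; [exact: PP'|exact: Hd'].
Qed.

Lemma itvcy_limit_point (x d : R) : 0 <= x -> 0 < d ->
  exists2 y, `[0, +oo[%classic y & 0 < `|y - x| < d.
Proof.
move=> x0 d0; exists (x + d / 2).
  by rewrite /= in_itv/= andbT addr_ge0// divr_ge0// ltW.
rewrite addrAC subrr add0r gtr0_norm ?divr_gt0//=; lra.
Qed.

Lemma itvco_limit_point (T t d : R) : 0 <= t < T -> 0 < d ->
  exists2 y, `[0, T[%classic y & 0 < `|y - t| < d.
Proof.
move=> /andP[t0 tT] d0; have [dT|dT] := leP d (T - t).
  exists (t + d / 2); first by rewrite /= in_itv/=; apply/andP; split; lra.
  rewrite addrAC subrr add0r gtr0_norm ?divr_gt0//=; lra.
exists (t + (T - t) / 2); first by rewrite /= in_itv/=; apply/andP; split; lra.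
rewrite addrAC subrr add0r gtr0_norm; first by apply/andP; split; lra.
lra.
Qed.

End uniform_and_joint.

(** * Change of variables for measurable integrands *)

Section change_of_variables.
Context {R : realType}.
Local Notation mu := (@lebesgue_measure R).
Local Open Scope ereal_scope.

Import HBNNSimple.

(** Both sides are limits along the same simple functions, and they agree on
    indicators by hypothesis. *)
Lemma ge0_integral_density d (T : measurableType d)
    (mu nu : {measure set T -> \bar R}) (rho : T -> R) (f : T -> \bar R)
    (D : set T) :
  measurable_fun setT rho -> (forall x, (0 <= rho x)%R) ->
  (forall B, measurable B -> nu B = \int[mu]_(x in B) (rho x)%:E) ->
  measurable D -> measurable_fun D f -> {in D, forall x, 0 <= f x} ->
  \int[nu]_(x in D) f x = \int[mu]_(x in D) (f x * (rho x)%:E).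
Proof.
move=> mrho rho0 nuE mD mf f0; pose h := nnsfun_approx mD mf.
have mrhoE A : measurable A -> measurable_fun A (EFin \o rho).
  by move=> mA; apply/measurable_EFinP; exact: measurable_funTS.
have fE x : D x -> (EFin \o h n) x @[n --> \oo] --> f x.
  move=> Dx; apply: cvg_nnsfun_approx => // y Dy; apply: f0.
  by rewrite inE.
have -> : \int[nu]_(x in D) f x =
    limn (fun n => \int[nu]_(x in D) (EFin \o h n) x).
  rewrite -monotone_convergence//.
  - by apply: eq_integral => x /[!inE] /fE Dx; exact/esym/cvg_lim.
  - by move=> n; exact/measurable_EFinP/measurable_funTS.
  - by move=> n x _; rewrite lee_fin.
  - by move=> x _ a b ab; rewrite lee_fin; exact/lefP/nd_nnsfun_approx.
have -> : \int[mu]_(x in D) (f x * (rho x)%:E) =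
    limn (fun n => \int[mu]_(x in D) ((h n x)%:E * (rho x)%:E)).
  rewrite -monotone_convergence//.
  - apply: eq_integral => x /[!inE] Dx; apply/esym/cvg_lim => //.
    by apply: cvgeZr => //; exact: fE.
  - move=> n; apply: emeasurable_funM; last exact: mrhoE.
    exact/measurable_EFinP/measurable_funTS.
  - by move=> n x _; rewrite mule_ge0// lee_fin.
  - move=> x _ a b ab; rewrite lee_wpmul2r ?lee_fin//.
    exact/lefP/nd_nnsfun_approx.
congr (limn _); apply/funext => n.
transitivity (\int[nu]_(x in D)
   (\sum_(y \in range (h n)) (y * \1_(h n @^-1` [set y]) x)%:E)).
  by apply: eq_integral => t tD; rewrite /= fimfunE -fsumEFin.
have indich r : measurable_fun D (fun x => (r * \1_(h n @^-1` [set r]) x)%:E).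
  by apply: (measurable_comp measurableT) => //; exact: measurable_funM.
rewrite ge0_integral_fsum//; last by move=> y x Dx; exact: nnfun_muleindic_ge0.
transitivity (\int[mu]_(x in D) (\sum_(y \in range (h n))
    (y * \1_(h n @^-1` [set y]) x)%:E * (rho x)%:E)); last first.
  apply: eq_integral => x xD.
  rewrite -ge0_mule_fsuml => [|y]; last exact: nnfun_muleindic_ge0.
  by rewrite fsumEFin // -(fimfunE _ x).
rewrite ge0_integral_fsum//; last 2 first.
  - by move=> y; apply: emeasurable_funM => //; exact: mrhoE.
  - by move=> y x Dx; rewrite mule_ge0 ?lee_fin//; exact: nnfun_muleindic_ge0.
apply: eq_fsbigr => r rhn.
rewrite integralZl_indic_nnsfun => //.
under [RHS]eq_integral do rewrite EFinM -muleA.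
rewrite ge0_integralZl//.
- under [in RHS]eq_integral do rewrite muleC.
  rewrite [in RHS](eq_integral ((EFin \o rho) \_ (h n @^-1` [set r]))).
    by rewrite -integral_mkcondr -nuE// ?integral_indic 1?setIC//;
      exact: measurableI.
  by move=> x xE; rewrite epatch_indic.
- apply: emeasurable_funM; last exact: mrhoE.
  exact/measurable_EFinP.
- by move=> t Et; rewrite mule_ge0 ?lee_fin.
- by move: rhn; rewrite inE => -[t _ <-]; rewrite lee_fin.
Qed.

(** The measure with density rho, pushed forward by g, is Lebesgue measure: it
    gives ]a, b] the mass g (eta b) - g (eta a) = b - a by the fundamental theorem
    of calculus. *)
Lemma lebesgue_measure_preimage_inverse (g rho eta : R -> R) :
  continuous rho -> (forall x, (0 < rho x)%R) ->
  (forall x, is_derive x (1 : R)%R g (rho x)) ->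
  cancel g eta -> cancel eta g -> continuous eta ->
  forall B : set (measurableTypeR R), measurable B ->
    mu (eta @^-1` B) = \int[mu]_(x in B) (rho x)%:E.
Proof.
move=> crho rho0 dg gK etaK ceta.
have mrho : measurable_fun [set: measurableTypeR R] (rho : _ -> measurableTypeR R).
  exact: continuous_measurable_fun.
have cg : continuous g.
  by move=> x; apply/differentiable_continuous/derivable1_diffP; case: (dg x).
have mg : measurable_fun [set: measurableTypeR R] (g : _ -> measurableTypeR R).
  exact: continuous_measurable_fun.
have meta : measurable_fun [set: measurableTypeR R] (eta : _ -> measurableTypeR R).
  exact: continuous_measurable_fun.
have gmono : {mono g : x y / (x <= y)%R}.
  apply: le_mono => x y xy.
  have [|c _ gE] := @MVT R g rho x y xy (fun z _ => dg z).
    exact: continuous_subspaceT.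
  by rewrite -subr_gt0 gE mulr_gt0// subr_gt0.
pose nu (A : set (measurableTypeR R)) : \bar R := \int[mu]_(x in A) (rho x)%:E.
have nu0 : nu set0 = 0 by rewrite /nu integral_set0.
have nu_ge0 A : 0 <= nu A.
  by apply: integral_ge0 => x _; rewrite lee_fin ltW.
have nu_sigma : semi_sigma_additive nu.
  move=> F mF tF mUF; rewrite /nu ge0_integral_bigcup//; last 2 first.
  - by apply/measurable_EFinP; exact: measurable_funTS.
  - by move=> x _; rewrite lee_fin ltW.
  apply: is_cvg_ereal_nneg_natsum_cond => n _ _.
  by apply: integral_ge0 => x _; rewrite lee_fin ltW.
pose nuM : {measure set (measurableTypeR R) -> \bar R} :=
  HB.pack nu (isMeasure.Build _ _ _ nu nu0 nu_ge0 nu_sigma).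
have key : forall A : set (measurableTypeR R), measurable A ->
    mu A = pushforward nuM (g : _ -> measurableTypeR R) A.
  pose gM := HB.pack_for {mfun measurableTypeR R >-> measurableTypeR R} g
    (@isMeasurableFun.Build _ _ (measurableTypeR R) (measurableTypeR R) g mg).
  apply: (@lebesgue_measure_unique R (pushforward nuM gM)) => X -[[a b]] /= _ <-.
  rewrite lebesgue_measure_itv/= lte_fin /pushforward/= /nu.
  have -> : g @^-1` `]a, b] = `]eta a, eta b]%classic.
    apply/seteqP; split => x /=; rewrite !in_itv/=.
      by rewrite -{1}(etaK a) -{1}(etaK b) (leW_mono gmono) gmono.
    by rewrite -{2}(etaK a) -{2}(etaK b) (leW_mono gmono) gmono.
  case: ifPn => [ab|]; last first.
    rewrite -leNgt => ba; rewrite set_itv_ge ?integral_set0//.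
    by rewrite bnd_simp -leNgt -gmono !etaK.
  have eab : (eta a < eta b)%R by rewrite -(leW_mono gmono) !etaK.
  rewrite integral_itv_obnd_cbnd; last exact/measurable_EFinP/measurable_funTS.
  rewrite (@continuous_FTC2 R rho g)// ?etaK//.
  - exact: continuous_subspaceT.
  - split; first by move=> x _; case: (dg x).
      exact/cvg_at_right_filter/cg.
    exact/cvg_at_left_filter/cg.
  - by move=> x _; rewrite derive1E; case: (dg x).
move=> B mB; rewrite key; last by rewrite -[X in measurable X]setTI; exact: meta.
rewrite /pushforward /= /nu; congr (integral _ _ _).
by apply/seteqP; split => x /=; rewrite gK.
Qed.

(** The substitution x = g y for an f that is merely measurable. It is written
    with the inverse eta because the integrands to be transformed are given as
    functions of eta x. *)
Lemma ge0_integral_substitution (g rho eta : R -> R) (D : set R)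
    (f : R -> \bar R) :
  continuous rho -> (forall x, (0 < rho x)%R) ->
  (forall x, is_derive x (1 : R)%R g (rho x)) ->
  cancel g eta -> cancel eta g -> continuous eta ->
  measurable (D : set (measurableTypeR R)) ->
  measurable_fun (D : set (measurableTypeR R)) f ->
  {in D, forall y, 0 <= f y} ->
  \int[mu]_(x in eta @^-1` D) f (eta x) = \int[mu]_(y in D) (f y * (rho y)%:E).
Proof.
move=> crho rho0 dg gK etaK ceta mD mf f0.
have meta : measurable_fun [set: measurableTypeR R] (eta : _ -> measurableTypeR R).
  exact: continuous_measurable_fun.
pose etaM := HB.pack_for {mfun measurableTypeR R >-> measurableTypeR R} eta
    (@isMeasurableFun.Build _ _ (measurableTypeR R) (measurableTypeR R) eta meta).
rewrite -(@ge0_integral_density _ _ mu (pushforward mu etaM) rho f D)//.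
- by rewrite ge0_integral_pushforward.
- exact: continuous_measurable_fun.
- by move=> x; exact/ltW.
- move=> B mB; rewrite /pushforward/=.
  exact: (lebesgue_measure_preimage_inverse crho rho0 dg gK etaK ceta).
Qed.

End change_of_variables.

(** * Tail integrals *)

Section tonelli.
Context {R : realType}.
Local Notation mu := (@lebesgue_measure R).
Local Open Scope ereal_scope.

Lemma tonelli_swap d (T : measurableType d)
    (m : {sigma_finite_measure set T -> \bar R}) (K : T * T -> \bar R) :
  measurable_fun setT K -> (forall p, 0 <= K p) ->
  \int[m]_x \int[m]_y K (x, y) = \int[m]_x \int[m]_y K (y, x).
Proof. by move=> mK K0; exact: (fubini_tonelli K mK K0). Qed.

(** The integral of f(x) f(y) over the half x < y of the square is the right-hand
    integral, and Tonelli's theorem exchanges it with the half y <= x. *)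
Lemma sqr_integral_le_tail (f : R -> R) (c : R) :
  measurable_fun (`]c, +oo[ : set (measurableTypeR R)) f ->
  (forall x, (c < x)%R -> (0 <= f x)%R) ->
  (\int[mu]_(x in `]c, +oo[) (f x)%:E) * (\int[mu]_(x in `]c, +oo[) (f x)%:E) <=
  2%:E * \int[mu]_(x in `]c, +oo[)
     ((f x)%:E * \int[mu]_(y in `]x, +oo[) (f y)%:E).
Proof.
move=> mf f0; set I := \int[mu]_(x in `]c, +oo[) (f x)%:E.
pose F x : \bar R := ((fun y => (f y)%:E) \_ `]c, +oo[) x.
have F0 x : 0 <= F x.
  by apply: erestrict_ge0 => y /=; rewrite in_itv/= andbT lee_fin => /f0.
have mF : measurable_fun [set: measurableTypeR R] F.
  by apply/(measurable_restrictT _ _).1 => //; exact/measurable_EFinP.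
have IF : I = \int[mu]_x F x by rewrite /I integral_mkcond.
pose K (p : measurableTypeR R * measurableTypeR R) : \bar R :=
  F p.1 * F p.2 * (p.1 < p.2)%R%:R%:E.
pose L (p : measurableTypeR R * measurableTypeR R) : \bar R :=
  F p.1 * F p.2 * (p.2 <= p.1)%R%:R%:E.
have mF1 : measurable_fun setT
    (fun p : measurableTypeR R * measurableTypeR R => F p.1).
  exact: measurableT_comp.
have mF2 : measurable_fun setT
    (fun p : measurableTypeR R * measurableTypeR R => F p.2).
  exact: measurableT_comp.
have mK : measurable_fun setT K.
  apply: emeasurable_funM; first exact: emeasurable_funM.
  apply/measurable_EFinP.
  apply: (measurableT_comp (f := fun b : bool => b%:R : R)) => //.
  exact: measurable_fun_ltr.
have mL : measurable_fun setT L.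
  apply: emeasurable_funM; first exact: emeasurable_funM.
  apply/measurable_EFinP.
  apply: (measurableT_comp (f := fun b : bool => b%:R : R)) => //.
  exact: measurable_fun_ler.
have K0 p : 0 <= K p by rewrite !mule_ge0// lee_fin.
have L0 p : 0 <= L p by rewrite !mule_ge0// lee_fin.
have mL1 x : measurable_fun setT (fun y => L (x, y)) by exact: measurableT_comp.
have mK1 x : measurable_fun setT (fun y => K (x, y)) by exact: measurableT_comp.
have oyE x y : (F \_ `]x, +oo[) y = F y * (x < y)%R%:R%:E.
  rewrite patchE; have [xy|yx] := ltP x y.
    by rewrite mem_set ?mule1//= in_itv/= xy.
  by rewrite memNset ?mule0//= in_itv/= ltNge yx.
have cyE x y : (F \_ `[x, +oo[) y = F y * (x <= y)%R%:R%:E.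
  rewrite patchE; have [xy|yx] := leP x y.
    by rewrite mem_set ?mule1//= in_itv/= xy.
  by rewrite memNset ?mule0//= in_itv/= leNgt yx.
have tailK x : \int[mu]_y K (x, y) = F x * \int[mu]_(y in `]x, +oo[) F y.
  rewrite [in RHS]integral_mkcond -ge0_integralZl//.
  - by apply: eq_integral => y _; rewrite oyE muleA.
  - by apply/(measurable_restrictT _ _).1 => //; exact: measurable_funTS.
  - by move=> y _; apply: erestrict_ge0.
have tailL x : \int[mu]_y L (y, x) = F x * \int[mu]_(y in `]x, +oo[) F y.
  rewrite integral_itv_obnd_cbnd; last exact: measurable_funTS.
  rewrite [in RHS]integral_mkcond -ge0_integralZl//.
  - by apply: eq_integral => y _; rewrite cyE muleA (muleC (F x)).
  - by apply/(measurable_restrictT _ _).1 => //; exact: measurable_funTS.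
  - by move=> y _; apply: erestrict_ge0.
have mG : measurable_fun setT (fun x => F x * \int[mu]_(y in `]x, +oo[) F y).
  have -> : (fun x => F x * \int[mu]_(y in `]x, +oo[) F y) = fubini_F mu K.
    by apply/funext => x; rewrite /fubini_F tailK.
  exact: measurable_fun_fubini_tonelli_F.
have G0 x : 0 <= F x * \int[mu]_(y in `]x, +oo[) F y.
  by apply: mule_ge0 => //; apply: integral_ge0.
have -> : I * I = \int[mu]_x (\int[mu]_y K (x, y) + \int[mu]_y L (x, y)).
  rewrite {1}IF -ge0_integralZr//; last by rewrite IF; apply: integral_ge0.
  apply: eq_integral => x _; rewrite IF -ge0_integralZl// -ge0_integralD//.
  apply: eq_integral => y _; rewrite /K /L /=.
  by case: ltP => _; rewrite mule1 mule0 ?addr0 ?add0r ?adde0 ?add0e.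
rewrite ge0_integralD//; last 4 first.
- by move=> x _; apply: integral_ge0.
- exact: measurable_fun_fubini_tonelli_F.
- by move=> x _; apply: integral_ge0.
- exact: measurable_fun_fubini_tonelli_F.
pose J := \int[mu]_x (F x * \int[mu]_(y in `]x, +oo[) F y).
have IK : \int[mu]_x \int[mu]_y K (x, y) = J.
  by apply: eq_integral => x _; exact: tailK.
have IL : \int[mu]_x \int[mu]_y L (x, y) = J.
  transitivity (\int[mu]_x \int[mu]_y L (y, x)).
    exact: (@tonelli_swap _ _ mu L mL L0).
  by apply: eq_integral => x _; exact: tailL.
have J0 : 0 <= J by apply: integral_ge0 => x _; exact: G0.
rewrite [leLHS](_ : _ = 2%:E * J); last first.
  transitivity (J + J); first by apply: f_equal2; [exact: IK|exact: IL].
  by rewrite -[in LHS](mul1e J) -ge0_muleDl// -EFinD.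
apply: lee_wpmul2l => //.
suff -> : J = \int[mu]_(x in `]c, +oo[)
    ((f x)%:E * \int[mu]_(y in `]x, +oo[) (f y)%:E) by [].
rewrite [in RHS]integral_mkcond; apply: eq_integral => x _.
rewrite patchE {1}/F patchE; case: ifPn => [/set_mem/=|_]; last by rewrite mul0e.
rewrite in_itv/= andbT => cx; congr (_ * _).
apply: eq_integral => y /set_mem/=; rewrite in_itv/= andbT => xy.
by rewrite /F patchE mem_set//= in_itv/= andbT (lt_trans cx).
Qed.

End tonelli.

(** * Flows on the half-line and their inverses *)

Section flow_inverse.
Context {R : realType}.
Implicit Types (f g : R -> R).

Lemma has_deriv_within_inverse (D D' : set R) f eta (x l : R) :
  l != 0 -> (forall y, D' y -> D (eta y)) -> (forall y, D' y -> f (eta y) = y) ->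
  eta (f x) = x -> eta @ within D' (nbhs (f x)) --> x ->
  has_deriv_within D f x l -> has_deriv_within D' eta (f x) l^-1.
Proof.
move=> l0 DD' fK etaK etac /has_deriv_within_slope[q [qx fq qc]].
have qec : (q (eta y))^-1 @[y --> within D' (nbhs (f x))] --> l^-1.
  apply: cvgV => //; apply: cvg_comp qc => A [d/= d0 Ad].
  move/cvgrPdist_lt : etac => /(_ _ d0)[e/= e0 He].
  by exists e => //= y yx Dy; apply: Ad => /=; [exact: He|exact: DD'].
apply/cvgrPdist_le => e e0.
move/cvgrPdist_le : qec => /(_ _ e0) [d/= d0 Hd].
exists d => //= y xy ynx Dy; rewrite etaK.
have yE : y - f x = q (eta y) * (eta y - x) by rewrite -fq fK.
have ex0 : eta y - x != 0.
  by apply: contra_neq ynx => e0'; apply/eqP; rewrite -subr_eq0 yE e0' mulr0.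
by rewrite yE invfM mulrCA mulfV// mulr1; exact: Hd.
Qed.

Record spatial_flow (T : R) (gamma rho : R -> R -> R) : Prop := {
  sf_gamma0 : forall t, 0 <= t < T -> gamma t 0 = 0;
  sf_phase : forall t, 0 <= t < T -> phase_space (rho t);
  sf_rho : forall t r, 0 <= t < T -> 0 <= r ->
    has_deriv_within `[0, +oo[ (gamma t) r (rho t r)
}.

(** Here h is the time derivative of rho, uniformly in r, and u the velocity field
    of the flow gamma. *)
Record regular_flow (T : R) (gamma rho h u : R -> R -> R) : Prop := {
  rf_spatial :> spatial_flow T gamma rho;
  rf_u : forall t r, 0 <= t < T -> 0 <= r ->
    has_deriv_within `[0, T[ (gamma^~ r) t (u t (gamma t r));
  rf_quot : forall t, 0 <= t < T -> {uniform `[0, +oo[,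
    (fun y r => (rho y r - rho t r) / (y - t)) @ within `[0, T[ t^' --> h t};
  rf_hcont : forall t, 0 <= t < T ->
    {uniform `[0, +oo[, h @ within `[0, T[ (nbhs t) --> h t}
}.

Definition inverse_flow (gamma : R -> R -> R) (t x : R) : R :=
  xget 0 [set r | 0 <= r /\ gamma t r = x].

Section spatial.
Implicit Types (t r s x y : R).
Variables (T : R) (gamma rho : R -> R -> R).
Hypothesis S : spatial_flow T gamma rho.
Local Notation eta := (inverse_flow gamma).

Lemma sf_rho_cont t r : 0 <= t < T -> 0 <= r ->
  rho t @ within `[0, +oo[ (nbhs r) --> rho t r.
Proof.
move=> tT r0; have [/subspace_continuousP + _] := sf_phase S tT.
by move=> /(_ r); apply; rewrite /= in_itv/= r0.
Qed.

Lemma sf_rho_gt0 t r : 0 <= t < T -> 0 <= r -> 0 < rho t r.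
Proof.
move=> tT r0; have [_ [a [b [/andP[a0 _] /(_ r r0)/andP[ar _]]]]] := sf_phase S tT.
exact: lt_le_trans ar.
Qed.

Lemma gamma_mean_value t x y : 0 <= t < T -> 0 <= x <= y ->
  exists2 c, x <= c <= y & gamma t y - gamma t x = rho t c * (y - x).
Proof.
move=> tT /andP[x0 xy]; apply: (@mean_value_within _ `[0, +oo[%classic) => //.
  by move=> z; rewrite /= !in_itv/= andbT => /andP[+ _]; exact: le_trans.
by move=> c /andP[xc _]; apply: (sf_rho S) => //; exact: le_trans xc.
Qed.

Lemma gamma_lt t x y : 0 <= t < T -> 0 <= x -> x < y -> gamma t x < gamma t y.
Proof.
move=> tT x0 xy; have [|c /andP[xc _] E] := @gamma_mean_value t x y tT.
  by rewrite x0 ltW.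
by rewrite -subr_gt0 E mulr_gt0 ?subr_gt0// sf_rho_gt0// (le_trans x0).
Qed.

Lemma gamma_ltE t x y : 0 <= t < T -> 0 <= x -> 0 <= y ->
  (gamma t x < gamma t y) = (x < y).
Proof.
move=> tT x0 y0; case: (ltgtP x y) => [xy|yx|->]; last by rewrite ltxx.
  exact: gamma_lt.
by apply/negbTE; rewrite -leNgt ltW// gamma_lt.
Qed.

Lemma gamma_ge0 t r : 0 <= t < T -> 0 <= r -> 0 <= gamma t r.
Proof.
move=> tT; rewrite le_eqVlt => /predU1P[<-|r0]; first by rewrite (sf_gamma0 S).
by rewrite ltW// -(sf_gamma0 S tT) gamma_lt.
Qed.

Lemma gamma_gt0 t r : 0 <= t < T -> 0 < r -> 0 < gamma t r.
Proof. by move=> tT r0; rewrite -(sf_gamma0 S tT) gamma_lt. Qed.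

Lemma gamma_surj t x : 0 <= t < T -> 0 <= x ->
  exists2 r, 0 <= r & gamma t r = x.
Proof.
move=> tT x0; have [_ [a [b [/andP[a0 _] ab]]]] := sf_phase S tT.
have xa0 : 0 <= x / a by rewrite divr_ge0// ltW.
have [||c + cE] := @IVT R (gamma t) 0 (x / a) x xa0.
- apply/subspace_continuousP => z /=; rewrite in_itv/= => /andP[z0 _].
  apply: has_deriv_within_cont (rho t z) _.
  apply: has_deriv_within_subset (sf_rho S tT z0) => w /=.
  by rewrite !in_itv/= andbT => /andP[].
- have [|c /andP[c0 _]] := @gamma_mean_value t 0 (x / a) tT.
    by rewrite lexx.
  rewrite (sf_gamma0 S tT) !subr0 => E.
  rewrite ge_min x0/= le_max E; apply/orP; right.
  rewrite -{1}(mulfVK (lt0r_neq0 a0) x) mulrC ler_wpM2r//.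
  by have /andP[] := ab _ c0.
- by rewrite in_itv/= => /andP[c0 _]; exists c.
Qed.

Lemma inverse_flowP t x : 0 <= t < T -> 0 <= x ->
  0 <= eta t x /\ gamma t (eta t x) = x.
Proof.
move=> tT x0; rewrite /inverse_flow; case: xgetP => [r ->//|/= H].
by have [r r0 E] := gamma_surj tT x0; exfalso; apply: (H r).
Qed.

Lemma inverse_flow_gamma t r : 0 <= t < T -> 0 <= r -> eta t (gamma t r) = r.
Proof.
move=> tT r0; have [e0 eE] := inverse_flowP tT (gamma_ge0 tT r0).
case: (ltgtP (eta t (gamma t r)) r) => // ne.
  by have := gamma_lt tT e0 ne; rewrite eE ltxx.
by have := gamma_lt tT r0 ne; rewrite eE ltxx.
Qed.

End spatial.

Section regular.
Implicit Types (t r s x y : R).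
Variables (T : R) (gamma rho h u : R -> R -> R).
Hypothesis F : regular_flow T gamma rho h u.
Local Notation eta := (inverse_flow gamma).

(** h t is a uniform limit of difference quotients of rho, which are continuous
    in r. *)
Lemma rf_h_cont t r : 0 <= t < T -> 0 <= r ->
  h t @ within `[0, +oo[ (nbhs r) --> h t r.
Proof.
move=> tT r0; apply/within_cvgP => e e0.
have e30 : 0 < e / 3 by rewrite divr_gt0.
have [d d0 Hd] := (uniform_quotientP _ _ _ _ _).1 (rf_quot F tT) _ e30.
have [y yT /andP[ynt ytd]] := itvco_limit_point tT d0.
have yt : y != t by rewrite -subr_eq0 -normr_gt0.
have {}Hd := Hd y yT yt ytd.
have yT' : 0 <= y < T by move: yT; rewrite /= in_itv.
have : (fun s => (rho y s - rho t s) / (y - t)) @ within `[0, +oo[ (nbhs r) -->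
    (rho y r - rho t r) / (y - t).
  by apply: cvgMl; apply: cvgB; exact: (sf_rho_cont F).
move=> /within_cvgP/(_ _ e30)[c c0 Hc]; exists c => // s s0 sr.
have {}Hc := Hc s s0 sr; have H1 := Hd s s0.
have H2 : `|h t r - (rho y r - rho t r) / (y - t)| < e / 3.
  by apply: Hd; rewrite /= in_itv/= r0.
move: Hc H1 H2; rewrite !ltr_norml => /andP[? ?] /andP[? ?] /andP[? ?].
by apply/andP; split; lra.
Qed.

(** Termwise differentiation: the quotients of gamma in t have in r the
    derivatives (rho y r - rho t r) / (y - t), which converge uniformly. *)
Lemma velocity_deriv t r : 0 <= t < T -> 0 <= r ->
  has_deriv_within `[0, +oo[ (fun s => u t (gamma t s)) r (h t r).
Proof.
move=> tT r0; apply/has_deriv_withinP => e e0.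
have e20 : 0 < e / 2 by rewrite divr_gt0.
have /within_cvgP/(_ _ e20)[d d0 Hd] := rf_h_cont tT r0.
exists d => // s s0 sr.
have s0' : 0 <= s by move: s0; rewrite /= in_itv/= andbT.
pose q y z := (gamma y z - gamma t z) / (y - t).
have qc z : 0 <= z -> q y z @[y --> within `[0, T[ t^'] --> u t (gamma t z).
  by move=> z0; exact: (rf_u F tT z0).
have PF : ProperFilter (within `[0, T[ t^').
  apply: Build_ProperFilter_ex => A [c/= c0 Ac].
  have [y yT /andP[yt ytc]] := itvco_limit_point tT c0.
  exists y; apply: Ac => //=; first by rewrite distrC.
  by rewrite -subr_eq0 -normr_gt0.
have lim : `|q y s - q y r - h t r * (s - r)| @[y --> within `[0, T[ t^'] -->
    `|u t (gamma t s) - u t (gamma t r) - h t r * (s - r)|.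
  apply: cvg_norm; apply: cvgB; last exact: cvg_cst.
  by apply: cvgB; exact: qc.
rewrite -(cvg_lim (@Rhausdorff R) lim).
apply: limr_le; first by apply/cvg_ex; eexists; exact: lim.
have [d' d'0 Hd'] := (uniform_quotientP _ _ _ _ _).1 (rf_quot F tT) _ e20.
exists d' => //= y ty ynt yT.
have yT' : 0 <= y < T by move: yT; rewrite /= in_itv.
have key a b : 0 <= a -> a <= b -> `|a - r| < d -> `|b - r| < d ->
    `|q y b - q y a - h t r * (b - a)| <= e * (b - a).
  move=> a0 ab ad bd.
  pose D := `[0, +oo[%classic : set R.
  have [| |c /andP[ac cb] cE] := @mean_value_within _ D (q y)
      (fun z => (rho y z - rho t z) / (y - t)) a b _ ab.
  - by move=> z; rewrite /D/= !in_itv/= andbT => /andP[+ _]; exact: le_trans.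
  - move=> c /andP[ac _]; have c0 : 0 <= c := le_trans a0 ac.
    have := has_deriv_withinM (has_deriv_withinB (sf_rho F yT' c0) (sf_rho F tT c0))
      (has_deriv_within_cst D (y - t)^-1 c).
    by rewrite mulr0 addr0.
  rewrite cE -mulrBl normrM (ger0_norm (_ : 0 <= b - a)) ?subr_ge0//.
  rewrite ler_wpM2r ?subr_ge0//.
  have c0 : D c by rewrite /D/= in_itv/= (le_trans a0).
  have cd : `|c - r| < d.
    move: ad bd; rewrite !ltr_norml => /andP[? ?] /andP[? ?].
    by apply/andP; split; lra.
  have ytd : `|y - t| < d' by rewrite distrC.
  have := Hd c c0 cd; have := Hd' y yT ynt ytd c c0.
  rewrite ler_norml !ltr_norml => /andP[? ?] /andP[? ?]; apply/andP; split; lra.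
have rr : `|r - r| < d by rewrite subrr normr0.
have [rs|sr'] := leP r s.
  by rewrite (ger0_norm (_ : 0 <= s - r)) ?subr_ge0//; exact: key.
rewrite (_ : _ - _ = - (q y r - q y s - h t r * (r - s))); last by ring.
rewrite normrN (distrC s) (ger0_norm (_ : 0 <= r - s)) ?subr_ge0 ?(ltW sr')//.
by apply: key => //; exact: ltW.
Qed.

Lemma h_joint_cvg t r : 0 <= t < T -> 0 <= r ->
  (fun p : R * R => h p.1 p.2) @
    within (`[0, T[ `*` `[0, +oo[) (nbhs (t, r)) --> h t r.
Proof.
move=> tT r0; apply/joint_cvgP => e e0.
have e20 : 0 < e / 2 by rewrite divr_gt0.
have /within_cvgP/(_ _ e20)[d d0 Hd] := rf_h_cont tT r0.
have [d' d'0 Hd'] := (uniform_within_nbhsP _ _ _ _).1 (rf_hcont F tT) _ e20.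
exists (Num.min d d'); first by rewrite lt_min d0.
move=> t' r' Jt Pr; rewrite !lt_min => /andP[_ td'] /andP[rd _].
have := Hd _ Pr rd; have := Hd' _ Jt td' _ Pr.
by rewrite !ltr_norml => /andP[? ?] /andP[? ?]; apply/andP; split; lra.
Qed.

Lemma rho_joint_cvg t r : 0 <= t < T -> 0 <= r ->
  (fun p : R * R => rho p.1 p.2) @
    within (`[0, T[ `*` `[0, +oo[) (nbhs (t, r)) --> rho t r.
Proof.
move=> tT r0; apply/joint_cvgP => e e0.
have e20 : 0 < e / 2 by rewrite divr_gt0.
have /within_cvgP/(_ _ e20)[d d0 Hd] := sf_rho_cont F tT r0.
have /within_cvgP/(_ _ ltr01)[c c0 Hc] := rf_h_cont tT r0.
have [d' d'0 Hd'] := (uniform_quotientP _ _ _ _ _).1 (rf_quot F tT) _ ltr01.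
(* M bounds the difference quotients of rho: one unit for the variation of h t in
   r, one for the distance of the quotient to h t. *)
pose M := `|h t r| + 2; have M0 : 0 < M by rewrite ltr_wpDl.
exists (Num.min (Num.min d c) (Num.min d' (e / 2 / M))).
  by rewrite !lt_min d0 c0 d'0/= divr_gt0.
move=> t' r' Jt Pr; rewrite !lt_min => /andP[_ /andP[td' tM]] /andP[/andP[rd rc] _].
have H1 := Hd _ Pr rd; have H2 := Hc _ Pr rc.
have H3 : `|rho t' r' - rho t r'| < e / 2.
  have [->|tt] := eqVneq t' t; first by rewrite subrr normr0.
  have tt0 : 0 < `|t' - t| by rewrite normr_gt0 subr_eq0.
  have H3 := Hd' _ Jt tt td' _ Pr.
  have : `|(rho t' r' - rho t r') / (t' - t)| <= M.
    rewrite /M; move: H2 H3; have := ler_norm (h t r); have := ler_norm (- h t r).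
    rewrite normrN !ltr_norml ler_norml => ? ? /andP[? ?] /andP[? ?].
    by apply/andP; split; lra.
  rewrite normf_div ler_pdivrMr// => /le_lt_trans; apply.
  by rewrite mulrC -ltr_pdivlMr.
move: H1 H3; rewrite !ltr_norml => /andP[? ?] /andP[? ?].
by apply/andP; split; lra.
Qed.

Lemma velocity_origin t : 0 <= t < T -> u t (gamma t 0) = 0.
Proof.
move=> tT; apply: (@has_deriv_within_unique _ `[0, T[%classic (gamma^~ 0) t).
- by move=> d d0; exact: itvco_limit_point tT d0.
- exact: (rf_u F).
- have tT' : `[0, T[%classic t by rewrite /= in_itv.
  apply: has_deriv_within_eq (has_deriv_within_cst _ 0 t) => // y.
  by rewrite inE/= in_itv/= => yT; rewrite (sf_gamma0 F).
Qed.

(** At distinct times the difference of velocities along the flow vanishes at the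
    origin and has the uniformly small derivative h t' - h t in r. *)
Lemma velocity_joint_cvg t r : 0 <= t < T -> 0 <= r ->
  (fun p : R * R => u p.1 (gamma p.1 p.2)) @
    within (`[0, T[ `*` `[0, +oo[) (nbhs (t, r)) --> u t (gamma t r).
Proof.
move=> tT r0; apply/(@joint_cvgP R _ _ (fun t r => u t (gamma t r))) => e e0.
have e20 : 0 < e / 2 by rewrite divr_gt0.
have r10 : 0 < r + 1 by rewrite ltr_wpDl.
have /has_deriv_within_cont/within_cvgP/(_ _ e20)[d d0 Hd] := velocity_deriv tT r0.
have er0 : 0 < e / 2 / (r + 1) by rewrite divr_gt0.
have [d' d'0 Hd'] := (uniform_within_nbhsP _ _ _ _).1 (rf_hcont F tT) _ er0.
exists (Num.min (Num.min d 1) d'); first by rewrite !lt_min d0 ltr01.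
move=> t' r' Jt Pr; rewrite !lt_min => /andP[_ td'] /andP[/andP[rd r1] _].
have H1 := Hd _ Pr rd.
have t'T : 0 <= t' < T by move: Jt; rewrite /= in_itv.
have r'0 : 0 <= r' by move: Pr; rewrite /= in_itv/= andbT.
pose D := `[0, +oo[%classic : set R.
have [| |c /andP[c0 _]] := @mean_value_within _ D
    (fun s => u t' (gamma t' s) - u t (gamma t s))
    (fun s => h t' s - h t s) 0 r' _ r'0.
- by move=> z; rewrite /D/= !in_itv/= andbT => /andP[].
- by move=> c /andP[c0 _]; apply: has_deriv_withinB; exact: velocity_deriv.
rewrite !velocity_origin// !subr0 => E.
have cD : D c by rewrite /D/= in_itv/= c0.
have H2 : `|u t' (gamma t' r') - u t (gamma t r')| <= e / 2.
  rewrite E normrM (ger0_norm r'0).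
  apply: le_trans (_ : e / 2 / (r + 1) * (r + 1) <= _); last first.
    by rewrite divfK ?gt_eqF.
  apply: ler_pM => //; first by rewrite distrC ltW// Hd'.
  by move: r1; rewrite ltr_norml => /andP[_ ?]; lra.
move: H1 H2; rewrite ler_norml !ltr_norml => /andP[? ?] /andP[? ?].
by apply/andP; split; lra.
Qed.

(** By monotonicity it is enough to follow two trajectories, those of r - e / 2
    and r + e / 2: at nearby times they still lie on either side of the points
    near x, so the inverse stays within e of r = eta t x. *)
Lemma inverse_flow_joint_cvg t x : 0 <= t < T -> 0 <= x ->
  (fun p : R * R => eta p.1 p.2) @
    within (`[0, T[ `*` `[0, +oo[) (nbhs (t, x)) --> eta t x.
Proof.
move=> tT x0; apply/joint_cvgP => e e0.
have [r0 rE] := inverse_flowP F tT x0; set r := eta t x in r0 rE *.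
(* A trajectory that is on one side of x at time t stays on that side of the
   points near x at the times near t. *)
have side s : 0 <= s -> gamma t s != x -> exists2 d : R, 0 < d &
    forall t' x', `[0, T[%classic t' -> `[0, +oo[%classic x' -> `|t' - t| < d ->
      `|x' - x| < d -> (gamma t s < x) = (gamma t' s < x') /\ gamma t' s != x'.
  move=> s0 sx; pose c := `|gamma t s - x| / 2.
  have c0 : 0 < c by rewrite divr_gt0// normr_gt0 subr_eq0.
  have /has_deriv_within_cont/within_cvgP/(_ _ c0)[d d0 Hd] := rf_u F tT s0.
  exists (Num.min d c); first by rewrite lt_min d0.
  move=> t' x' Jt Px; rewrite !lt_min => /andP[td _] /andP[_ xc].
  have := Hd _ Jt td; move: xc sx; rewrite /c.
  case: (ltgtP (gamma t s) x) => // sx.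
    rewrite (ltr0_norm (_ : gamma t s - x < 0)) ?subr_lt0//.
    rewrite !ltr_norml => /andP[? ?] _ /andP[? ?].
    have ? : gamma t' s < x' by lra.
    by rewrite lt_eqF.
  rewrite (gtr0_norm (_ : 0 < gamma t s - x)) ?subr_gt0//.
  rewrite !ltr_norml => /andP[? ?] _ /andP[? ?].
  have ? : x' < gamma t' s by lra.
  by rewrite gt_eqF// ltNge ltW.
have re0 : 0 <= r + e / 2 by rewrite addr_ge0// divr_ge0// ltW.
have up : x < gamma t (r + e / 2) by rewrite -rE (gamma_lt F)// ltrDl divr_gt0.
have [|d d0 Hd] := side _ re0; first by rewrite gt_eqF.
have {}Hd t' x' : `[0, T[%classic t' -> `[0, +oo[%classic x' -> `|t' - t| < d ->
    `|x' - x| < d -> eta t' x' < r + e / 2.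
  move=> Jt Px td xd; have [] := Hd _ _ Jt Px td xd.
  have t'T : 0 <= t' < T by move: Jt; rewrite /= in_itv.
  have x'0 : 0 <= x' by move: Px; rewrite /= in_itv/= andbT.
  have [r'0 r'E] := inverse_flowP F t'T x'0.
  rewrite -(gamma_ltE F t'T r'0 re0) r'E (ltNge (gamma t _)) (ltW up)/=.
  by case: ltgtP.
have [|re] := ltP (r - e / 2) 0.
  move=> re; exists d => // t' x' Jt Px td xd.
  have t'T : 0 <= t' < T by move: Jt; rewrite /= in_itv.
  have x'0 : 0 <= x' by move: Px; rewrite /= in_itv/= andbT.
  have [r'0 _] := inverse_flowP F t'T x'0.
  have := Hd _ _ Jt Px td xd; rewrite ltr_norml => ?; apply/andP; split; lra.
have dn : gamma t (r - e / 2) < x.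
  by move: (@gamma_lt _ _ _ F t (r - e / 2) r tT re); rewrite rE; apply; lra.
have [|d' d'0 Hd'] := side _ re; first by rewrite lt_eqF.
exists (Num.min d d'); first by rewrite lt_min d0.
move=> t' x' Jt Px; rewrite !lt_min => /andP[td td'] /andP[xd xd'].
have := Hd _ _ Jt Px td xd; have [] := Hd' _ _ Jt Px td' xd'.
have t'T : 0 <= t' < T by move: Jt; rewrite /= in_itv.
have x'0 : 0 <= x' by move: Px; rewrite /= in_itv/= andbT.
have [r'0 r'E] := inverse_flowP F t'T x'0.
rewrite dn -{1}r'E (gamma_ltE F)// => /esym ? _ ?.
by rewrite ltr_norml; apply/andP; split; lra.
Qed.

Lemma velocity_eta t x : 0 <= t < T -> 0 <= x ->
  u t x = u t (gamma t (eta t x)).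
Proof. by move=> tT x0; have [_ ->] := inverse_flowP F tT x0. Qed.

Definition velocity_gradient t x := h t (eta t x) / rho t (eta t x).

Lemma velocity_continuous :
  {within `[0, T[ `*` `[0, +oo[, continuous (fun p : R * R => u p.1 p.2)}.
Proof.
apply/joint_continuousP => t x; rewrite /= !in_itv/= andbT => tT x0.
have [r0 _] := inverse_flowP F tT x0.
rewrite (velocity_eta tT x0).
have PP (t' x' : R) : `[0, T[%classic t' -> `[0, +oo[%classic x' ->
    `[0, +oo[%classic (eta t' x').
  rewrite /= !in_itv/= !andbT => t'T x'0.
  by have [] := inverse_flowP F t'T x'0.
have := @joint_cvg_comp R _ _ _ (fun t r => u t (gamma t r)) eta t x PP
  (velocity_joint_cvg tT r0) (inverse_flow_joint_cvg tT x0).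
apply: cvg_trans; apply: near_eq_cvg.
near=> p; have [] : (`[0, T[ `*` `[0, +oo[) p by near: p; exact: withinT.
rewrite /= !in_itv/= andbT => pT p0.
by rewrite [RHS]velocity_eta.
Unshelve. all: by end_near. Qed.

Lemma velocity_gradient_continuous : {within `[0, T[ `*` `[0, +oo[,
  continuous (fun p : R * R => velocity_gradient p.1 p.2)}.
Proof.
apply/joint_continuousP => t x; rewrite /= !in_itv/= andbT => tT x0.
have [r0 _] := inverse_flowP F tT x0.
have PP (t' x' : R) : `[0, T[%classic t' -> `[0, +oo[%classic x' ->
    `[0, +oo[%classic (eta t' x').
  rewrite /= !in_itv/= !andbT => t'T x'0.
  by have [] := inverse_flowP F t'T x'0.
apply: cvgM.
  exact: joint_cvg_comp PP (h_joint_cvg tT r0) (inverse_flow_joint_cvg tT x0).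
apply: cvgV; first by rewrite gt_eqF// (sf_rho_gt0 F).
exact: joint_cvg_comp PP (rho_joint_cvg tT r0) (inverse_flow_joint_cvg tT x0).
Qed.

Lemma eta_cvg t x : 0 <= t < T -> 0 <= x ->
  eta t @ within `[0, +oo[ (nbhs x) --> eta t x.
Proof.
move=> tT x0; apply/within_cvgP => e e0.
have /joint_cvgP/(_ e e0)[d d0 Hd] := inverse_flow_joint_cvg tT x0.
exists d => // y y0 yx; apply: Hd => //; last by rewrite subrr normr0.
Qed.

Lemma velocity_has_deriv t x : 0 <= t < T -> 0 <= x ->
  has_deriv_within `[0, +oo[ (u t) x (velocity_gradient t x).
Proof.
move=> tT x0; have [r0 rE] := inverse_flowP F tT x0.
have x0' : `[0, +oo[%classic x by rewrite /= in_itv/= x0.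
have PP x' : `[0, +oo[%classic x' -> `[0, +oo[%classic (eta t x').
  by rewrite /= !in_itv/= !andbT => x'0; have [] := inverse_flowP F tT x'0.
have deta : has_deriv_within `[0, +oo[ (eta t) x (rho t (eta t x))^-1.
  rewrite -{1}rE; apply: (@has_deriv_within_inverse `[0, +oo[%classic) PP _ _ _ _.
  - by rewrite gt_eqF// (sf_rho_gt0 F).
  - by move=> y; rewrite /= in_itv/= andbT => y0; have [] := inverse_flowP F tT y0.
  - by rewrite rE.
  - by rewrite rE; exact: eta_cvg.
  - exact: (sf_rho F).
have := has_deriv_within_comp PP deta (velocity_deriv tT r0).
apply: has_deriv_within_eq => // y; rewrite inE/= in_itv/= andbT => y0.
by rewrite -velocity_eta.
Qed.

End regular.
End flow_inverse.

(** * Split integrals *)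

Section split_integrals.
Context {R : realType}.
Local Notation mu := (@lebesgue_measure R).
Implicit Types (r v w C : R) (f g : R -> R).

Lemma integrable_itv_obnd_cbnd r (b : itv_bound R) (f : R -> \bar R) :
  mu.-integrable [set` Interval (BRight r) b] f <->
  mu.-integrable [set` Interval (BLeft r) b] f.
Proof.
split => [/integrableP[mf fi]|]; last first.
  apply: integrableS => //; apply: subset_itvr => //.
  by rewrite bnd_simp.
have mf' := (emeasurable_fun_itv_obnd_cbndP _ _ _).1 mf.
apply/integrableP; split => //.
rewrite -integral_itv_obnd_cbnd//; exact: measurableT_comp.
Qed.

Lemma integrable_itv_bndo_bndc (a : itv_bound R) r (f : R -> \bar R) :
  mu.-integrable [set` Interval a (BLeft r)] f <->
  mu.-integrable [set` Interval a (BRight r)] f.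
Proof.
split => [/integrableP[mf fi]|]; last first.
  apply: integrableS => //; apply: subset_itvl => //.
  by rewrite bnd_simp.
have mf' := (emeasurable_fun_itv_bndo_bndcP _ _ _).1 mf.
apply/integrableP; split => //.
rewrite -integral_itv_bndo_bndc//; exact: measurableT_comp.
Qed.

Lemma integrable_EFinZl (D : set (measurableTypeR R)) (c : R) f :
  measurable D -> mu.-integrable D (EFin \o f) ->
  mu.-integrable D (EFin \o (fun s => c * f s)).
Proof.
move=> mD fi; apply: eq_integrable (integrableZl mD c fi) => //.
Qed.

Lemma integrable_EFinD (D : set (measurableTypeR R)) f g :
  measurable D -> mu.-integrable D (EFin \o f) -> mu.-integrable D (EFin \o g) ->
  mu.-integrable D (EFin \o (fun s => f s + g s)).
Proof.
move=> mD fi gi; apply: eq_integrable (integrableD mD fi gi) => //.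
Qed.

(** The endpoints are negligible. They have to be removed because the sign of the
    momentum is known for s > 0 only. *)
Lemma is_split_integral_open r f g v : is_split_integral r f g v <->
  [/\ mu.-integrable `]0, r[ (EFin \o f), mu.-integrable `]r, +oo[ (EFin \o g) &
    v = \int[mu]_(s in `]0, r[) f s + \int[mu]_(s in `]r, +oo[) g s].
Proof.
rewrite /is_split_integral.
split => -[fi gi ->].
- have fi1 : mu.-integrable `]0, r] (EFin \o f) by apply/integrable_itv_obnd_cbnd.
  have fi2 : mu.-integrable `]0, r[ (EFin \o f) by apply/integrable_itv_bndo_bndc.
  have gi1 : mu.-integrable `]r, +oo[ (EFin \o g) by apply/integrable_itv_obnd_cbnd.
  split => //; rewrite -!Rintegral_itv_obnd_cbnd//.
  by rewrite Rintegral_itv_bndo_bndc.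
- have fi1 : mu.-integrable `]0, r] (EFin \o f) by apply/integrable_itv_bndo_bndc.
  split; [exact/integrable_itv_obnd_cbnd|exact/integrable_itv_obnd_cbnd|].
  rewrite -!Rintegral_itv_obnd_cbnd//.
  by rewrite Rintegral_itv_bndo_bndc.
Qed.

Lemma is_split_integral_eq r f g f' g' v :
  (forall s, 0 < s < r -> f s = f' s) -> (forall s, r < s -> g s = g' s) ->
  is_split_integral r f g v -> is_split_integral r f' g' v.
Proof.
move=> ff' gg' /is_split_integral_open[fi gi ->]; apply/is_split_integral_open.
have ff s : s \in `]0, r[%classic -> f s = f' s.
  by rewrite inE/= in_itv/=; exact: ff'.
have gg s : s \in `]r, +oo[%classic -> g s = g' s.
  by rewrite inE/= in_itv/= andbT; exact: gg'.
split.
- by apply: eq_integrable fi => // s /ff/= ->.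
- by apply: eq_integrable gi => // s /gg/= ->.
- by congr (_ + _); apply: eq_Rintegral.
Qed.

Lemma is_split_integral_inj r f g v v' :
  is_split_integral r f g v -> is_split_integral r f g v' -> v = v'.
Proof. by move=> [_ _ ->] [_ _ ->]. Qed.

Lemma is_split_integral_comb r f g f' g' v v' (c : R) :
  is_split_integral r f g v -> is_split_integral r f' g' v' ->
  is_split_integral r (fun s => c * f s + f' s) (fun s => c * g s + g' s)
    (c * v + v').
Proof.
move=> /is_split_integral_open[fi gi ->] /is_split_integral_open[fi' gi' ->].
apply/is_split_integral_open; split.
- by apply: integrable_EFinD => //; exact: integrable_EFinZl.
- by apply: integrable_EFinD => //; exact: integrable_EFinZl.
- rewrite !RintegralD ?RintegralZl//; first (by ring); exact: integrable_EFinZl.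
Qed.

(** The integrability of k is part of the conclusion: it is how the finiteness of
    the weighted mass is obtained. *)
Lemma is_split_integral_le r f g v (k : R -> R) :
  (forall s, 0 < s < r -> f s <= 0) ->
  (forall s, r < s -> 0 <= k s <= - g s) ->
  measurable_fun `]r, +oo[ k ->
  is_split_integral r f g v ->
  mu.-integrable `]r, +oo[ (EFin \o k) /\
  v <= - \int[mu]_(s in `]r, +oo[) k s.
Proof.
move=> f0 kg mk /is_split_integral_open[fi gi ->].
have ki : mu.-integrable `]r, +oo[ (EFin \o k).
  apply: le_integrable gi => //; first exact/measurable_EFinP.
  move=> s; rewrite /= in_itv/= andbT => /kg/andP[k0 ks].
  rewrite lee_fin ger0_norm//; apply: le_trans ks _.
  by rewrite -normrN ler_norm.
split => //.
have I1 : \int[mu]_(s in `]0, r[) f s <= 0.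
  have := @le_Rintegral _ _ _ mu `]0, r[ f (fun s => 0 * f s).
  rewrite RintegralZl// mul0r; apply => //; first exact: integrable_EFinZl.
  by move=> s; rewrite /= in_itv/= mul0r; exact: f0.
have I2 : \int[mu]_(s in `]r, +oo[) g s <= - \int[mu]_(s in `]r, +oo[) k s.
  rewrite -mulN1r -RintegralZl//; apply: le_Rintegral => //.
    exact: integrable_EFinZl.
  move=> s; rewrite /= in_itv/= andbT => /kg/andP[k0 ks].
  by rewrite mulN1r lerNr.
by rewrite -[leRHS]add0r lerD.
Qed.

End split_integrals.

(** * The decay rate of Q(gamma) rho *)

Section growth.
Context {R : realType}.
Local Notation mu := (@lebesgue_measure R).
Variables (delta : R -> R -> R) (Q dQ : R -> R) (C : R).
Hypotheses (hQ_pos : forall r, 0 <= r -> 0 < Q r) (hC : 0 < C).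
Hypothesis hcond1 : forall r s, 0 <= s < r -> wedge (s, r) ->
       0 <= dQ r / Q r * delta s r + partial2 delta s r.
Hypothesis hcond2 : forall r s, 0 <= r <= s -> wedge (r, s) ->
       C / Q s <= dQ r / Q r * delta r s + partial1 delta r s.
Variables (z0 G P : R -> R).
Hypotheses (hz0 : forall s, 0 < s -> z0 s <= 0).
Hypotheses (G0 : G 0 = 0) (Ginc : forall r s, 0 <= r -> r < s -> G r < G s).
Hypothesis P0 : forall r, 0 <= r -> 0 < P r.

Let G_ge0 r : 0 <= r -> 0 <= G r.
Proof.
by rewrite le_eqVlt => /predU1P[<-|r0]; [rewrite G0|rewrite -G0 ltW// Ginc].
Qed.

Let Gwedge r s : 0 <= r -> r < s -> wedge (G r, G s).
Proof.
move=> r0 rs; have Grs := Ginc r0 rs.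
split; first by rewrite /= G_ge0//= ltW.
by move=> [_ Gs0]; have := G_ge0 r0; rewrite leNgt -Gs0 Grs.
Qed.

(** The left-hand side is the logarithmic derivative of Q(gamma) rho. Under the
    integral signs the kernel enters through the two combinations bounded below
    by hcond1 and hcond2, multiplied by z0 / P <= 0. *)
Lemma growth_rate_le (r v w : R) : 0 <= r ->
  measurable_fun `]r, +oo[ (fun s => - z0 s / (Q (G s) * P s)) ->
  is_split_integral r (fun s => delta (G s) (G r) / P s * z0 s)
                      (fun s => delta (G r) (G s) / P s * z0 s) v ->
  is_split_integral r (fun s => partial2 delta (G s) (G r) / P s * z0 s)
                      (fun s => partial1 delta (G r) (G s) / P s * z0 s) w ->
  mu.-integrable `]r, +oo[ (EFin \o (fun s => - z0 s / (Q (G s) * P s))) /\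
  dQ (G r) / Q (G r) * v + w <=
    - (C * \int[mu]_(s in `]r, +oo[) (- z0 s / (Q (G s) * P s))).
Proof.
move=> r0 mk hv hw.
have [] := is_split_integral_le (k := fun s => C * (- z0 s / (Q (G s) * P s)))
  _ _ _ (is_split_integral_comb (dQ (G r) / Q (G r)) hv hw).
- move=> s /andP[s0 sr].
  rewrite (_ : _ + _ = (dQ (G r) / Q (G r) * delta (G s) (G r) +
      partial2 delta (G s) (G r)) * (z0 s / P s)); last by ring.
  apply: mulr_ge0_le0.
    apply: hcond1; first by rewrite G_ge0 ?(ltW s0)//= Ginc// ltW.
    by apply: Gwedge => //; exact: ltW.
  by rewrite pmulr_lle0 ?hz0// invr_gt0 P0// ltW.
- move=> s rs; have s0 := le_lt_trans r0 rs.
  have z0s : 0 <= - z0 s by rewrite oppr_ge0 hz0.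
  have QG := hQ_pos (G_ge0 (ltW s0)); have Ps := P0 (ltW s0).
  rewrite !(mulr_ge0, invr_ge0)//= ?(ltW hC) ?(ltW QG) ?(ltW Ps)//=.
  rewrite [leRHS](_ : _ = (dQ (G r) / Q (G r) * delta (G r) (G s) +
      partial1 delta (G r) (G s)) * (- z0 s / P s)); last by ring.
  rewrite [leLHS](_ : _ = C / Q (G s) * (- z0 s / P s)); last first.
    by rewrite invfM; ring.
  rewrite ler_wpM2r ?divr_ge0 ?(ltW Ps)//.
  apply: hcond2; last exact: Gwedge.
  by rewrite G_ge0//= ltW// Ginc.
- by apply: measurable_funM.
move=> ki H.
have aki : mu.-integrable `]r, +oo[ (EFin \o (fun s => - z0 s / (Q (G s) * P s))).
  have := integrable_EFinZl C^-1 (measurable_itv _) ki.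
  apply: eq_integrable => // s _.
  by rewrite /= mulKf// gt_eqF.
by split => //; rewrite -RintegralZl.
Qed.

End growth.

(** * A discrete Riccati inequality *)

Section riccati.
Context {R : realType}.

(** While F is at least 2^k F(0), it doubles within time 1 / (c 2^k F(0)). These
    times add up to 2 / (c F(0)), where F would exceed every power of 2. *)
Lemma riccati_blowup (F : R -> R) (T c : R) : 0 < c -> 0 < F 0 ->
  (forall t' t, 0 <= t' -> t' <= t -> t < T ->
     F t' + c * (t - t') * F t' ^+ 2 <= F t) ->
  T <= 2 / (c * F 0).
Proof.
move=> c0 F0 step; rewrite leNgt; apply/negP => TT.
set B := 2 / (c * F 0) in TT.
have B0 : 0 < B by rewrite divr_gt0// mulr_gt0.
have key k t : B * (1 - 2 ^- k) <= t -> t < T -> 2 ^+ k * F 0 <= F t.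
  elim: k t => [|k IH] t.
    rewrite expr0 invr1 subrr mulr0 => t0 tT; rewrite mul1r.
    apply: le_trans (step 0 t _ t0 tT) => //.
    by rewrite lerDl !mulr_ge0 ?subr0// ?ltW// exprn_gt0.
  move=> Bt tT; pose t' := B * (1 - 2 ^- k).
  have p0 : 0 < (2 ^+ k : R) by rewrite exprn_gt0.
  have tt' : t' + B * 2 ^- k.+1 <= t.
    apply: le_trans Bt; rewrite /t' -mulrDr (ler_wpM2l (ltW B0))//.
    rewrite exprS invfM; have : 0 < (2 ^+ k : R)^-1 by rewrite invr_gt0.
    by set z := (2 ^+ k)^-1; move=> z0; lra.
  have t'0 : 0 <= t'.
    rewrite mulr_ge0 ?(ltW B0)// subr_ge0 invf_le1// exprn_ege1// ler1n//.
  have d0 : 0 < B * 2 ^- k.+1 by rewrite mulr_gt0// invr_gt0 exprn_gt0.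
  have t't : t' < t by apply: lt_le_trans tt'; rewrite ltrDl.
  have IH' := IH t' (lexx _) (lt_trans t't tT).
  have Ft'0 : 0 < F t' by apply: lt_le_trans IH'; rewrite mulr_gt0.
  apply: le_trans (step _ _ t'0 (ltW t't) tT).
  have : F t' <= c * (t - t') * F t' ^+ 2.
    rewrite expr2 mulrA ler_peMl ?(ltW Ft'0)//.
    apply: (@le_trans _ _ (c * (B * 2 ^- k.+1) * (2 ^+ k * F 0))).
      rewrite /B exprS invfM invfM le_eqVlt; apply/orP; left; apply/eqP.
      by field; rewrite !gt_eqF//=.
    apply: ler_pM => //; [exact/ltW/mulr_gt0|exact/ltW/mulr_gt0|].
    rewrite ler_wpM2l ?(ltW c0)//; lra.
  by rewrite (exprS 2 k) -mulrA; move: IH'; lra.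
have [k Hk] : exists k, F B < 2 ^+ k * F 0.
  exists (Num.bound `|F B / F 0|).
  rewrite -ltr_pdivrMr//; apply: le_lt_trans (ler_norm _) _.
  apply: lt_trans (archi_boundP (normr_ge0 _)) _.
  by rewrite -natrX ltr_nat ltn_expl.
have H : 2 ^+ k * F 0 <= F B.
  by apply: key => //; rewrite ler_piMr ?(ltW B0)// gerBl invr_ge0 exprn_ge0.
by move: Hk; rewrite ltNge H.
Qed.

End riccati.

(** * Growth of the weighted mass *)

(** The factor z0 that multiplies every kernel of the system. *)
Definition momentum_density (R : realType) (n : nat) (omega0 : R -> R) (s : R) :=
  s ^+ n.-1 * omega0 s.

Section dynamics.
Context {R : realType}.
Local Notation mu := (@lebesgue_measure R).
Variables (n : nat) (delta : R -> R -> R) (omega0 Q dQ : R -> R) (C : R).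
Hypotheses (homega0 : forall r, 0 < r -> omega0 r <= 0)
  (hdelta_pos : forall r s, 0 < r <= s -> 0 < delta r s)
  (hQ_pos : forall r, 0 <= r -> 0 < Q r)
  (hQ : forall r, 0 <= r -> has_deriv_within `[0, +oo[ Q r (dQ r))
  (hC : 0 < C)
  (hcond1 : forall r s, 0 <= s < r -> wedge (s, r) ->
       0 <= dQ r / Q r * delta s r + partial2 delta s r)
  (hcond2 : forall r s, 0 <= r <= s -> wedge (r, s) ->
       C / Q s <= dQ r / Q r * delta r s + partial1 delta r s).
Local Notation z0 := (momentum_density n omega0).
Hypothesis mz0 : measurable_fun `](0 : R), +oo[ z0.

Lemma z0_le0 s : 0 < s -> z0 s <= 0.
Proof. by move=> s0; rewrite mulr_ge0_le0 ?homega0// exprn_ge0// ltW. Qed.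

Section one_solution.
Variables (T : R) (gamma rho : R -> R -> R).
Hypothesis S : system_solution n delta omega0 T gamma rho.
Implicit Types (t r s : R).

Lemma system_spatial : spatial_flow T gamma rho.
Proof.
split; [exact: (sys_gamma0 S)|exact: (sys_phase S)|exact: (sys_gamma_rho S)].
Qed.
Let SF := system_spatial.

(** The reciprocal of Q(gamma) rho. Unlike rho alone it is monotone in time, and
    it is its growth that the hypotheses on Q control. *)
Definition weight t s := (Q (gamma t s) * rho t s)^-1.

Definition mass t r := \int[mu]_(s in `]r, +oo[) (- z0 s * weight t s).

Lemma weight_gt0 t s : 0 <= t < T -> 0 <= s -> 0 < weight t s.
Proof.
move=> tT s0; rewrite invr_gt0 mulr_gt0 ?(sf_rho_gt0 SF)//.
by rewrite hQ_pos// (gamma_ge0 SF).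
Qed.

Lemma mass_density_ge0 t s : 0 <= t < T -> 0 < s -> 0 <= - z0 s * weight t s.
Proof.
move=> tT s0; rewrite mulr_ge0 ?(ltW (weight_gt0 tT _)) ?(ltW s0)//.
by rewrite oppr_ge0 z0_le0.
Qed.

Lemma measurable_mass_density t r : 0 <= t < T -> 0 <= r ->
  measurable_fun `]r, +oo[ (fun s => - z0 s * weight t s).
Proof.
move=> tT r0; have sub : `]r, +oo[%classic `<=` (`](0 : R), +oo[%classic : set R).
  by move=> s; rewrite /= !in_itv/= !andbT; exact: le_lt_trans.
apply: measurable_funM.
  by apply: measurableT_comp => //; exact: measurable_funS mz0.
apply: (@measurable_funS _ _ _ _ `[(0 : R), +oo[%classic) => //.
  by move=> s; rewrite /= !in_itv/= !andbT => /(le_lt_trans r0)/ltW.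
apply: subspace_continuous_measurable_fun => //.
apply/subspace_continuousP => s /=; rewrite in_itv/= andbT => s0.
apply: cvgV.
  rewrite mulf_neq0// gt_eqF ?(sf_rho_gt0 SF)//.
  by rewrite hQ_pos// (gamma_ge0 SF).
apply: cvgM; last exact: (sf_rho_cont SF).
have PP y : `[0, +oo[%classic y -> `[0, +oo[%classic (gamma t y).
  by rewrite /= !in_itv/= !andbT => y0; exact: (gamma_ge0 SF).
exact: has_deriv_within_cont (has_deriv_within_comp PP (sf_rho SF tT s0)
  (hQ (gamma_ge0 SF tT s0))).
Qed.

(** The rate L is the one of [growth_rate_le]: the weight is the inverse of
    Q(gamma) rho, whose logarithmic derivative it is. *)
Lemma weight_growth t r : 0 <= t < T -> 0 <= r -> exists L : R,
  [/\ has_deriv_within `[0, T[ (weight^~ r) t (- L * weight t r),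
    mu.-integrable `]r, +oo[ (EFin \o (fun s => - z0 s * weight t s)) &
    L <= - (C * mass t r)].
Proof.
move=> tT r0; have [v [dv hv]] := sys_gamma_eq S tT r0.
have [drho /(_ t tT)[q _ /(_ r r0)[w [dE hw]]]] := sys_rho_eq S.
have r0' : `[0, +oo[%classic r by rewrite /= in_itv/= r0.
have drhor := uniform_quotient_has_deriv q r0'.
have gt0 := gamma_ge0 SF tT r0; have Qg := hQ_pos gt0.
have rt := sf_rho_gt0 SF tT r0.
have [ki Lle] := growth_rate_le hQ_pos hC hcond1 hcond2 z0_le0
  (sf_gamma0 SF tT) (fun x y => @gamma_lt _ _ _ _ SF t x y tT)
  (fun x => @sf_rho_gt0 _ _ _ _ SF t x tT) r0
  (measurable_mass_density tT r0) hv hw.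
exists (dQ (gamma t r) / Q (gamma t r) * v + w); split => //.
have PP y : `[0, T[%classic y -> `[0, +oo[%classic (gamma y r).
  by rewrite /= !in_itv/= andbT => yT; exact: (gamma_ge0 SF).
have H := has_deriv_withinV _
  (has_deriv_withinM (has_deriv_within_comp PP dv (hQ gt0)) drhor).
rewrite (_ : _ * _ = - (dQ (gamma t r) * v * rho t r + Q (gamma t r) * drho t r) /
  (Q (gamma t r) * rho t r) ^+ 2); first by apply: H; rewrite mulf_neq0// gt_eqF.
by rewrite dE /weight; field; rewrite !gt_eqF.
Qed.

Lemma mass_density_integrable t r : 0 <= t < T -> 0 <= r ->
  mu.-integrable `]r, +oo[ (EFin \o (fun s => - z0 s * weight t s)).
Proof. by move=> tT r0; have [L []] := weight_growth tT r0. Qed.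

Lemma mass_ge0 t r : 0 <= t < T -> 0 <= r -> 0 <= mass t r.
Proof.
move=> tT r0; apply: Rintegral_ge0 => s; rewrite /= in_itv/= andbT => rs.
by apply: mass_density_ge0 => //; exact: le_lt_trans rs.
Qed.

Lemma weight_mean_value t' t r : 0 <= t' -> t' <= t -> t < T -> 0 <= r ->
  exists2 c, t' <= c <= t &
    C * mass c r * weight c r * (t - t') <= weight t r - weight t' r.
Proof.
move=> t'0 t't tT r0.
have [L HL] : {L : R -> R & forall y, 0 <= y < T ->
    has_deriv_within `[0, T[ (weight^~ r) y (- L y * weight y r) /\
    L y <= - (C * mass y r)}.
  apply: (@choice _ _ (fun y L => 0 <= y < T ->
    has_deriv_within `[0, T[ (weight^~ r) y (- L * weight y r) /\
    L <= - (C * mass y r))) => y.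
  case: (pselect (0 <= y < T)) => [yT|?]; last by exists 0.
  by have [L [? _ ?]] := weight_growth yT r0; exists L.
have [| |c /andP[tc ct] E] := @mean_value_within _ `[0, T[%classic (weight^~ r)
    (fun y => - L y * weight y r) t' t _ t't.
- move=> y; rewrite /= !in_itv/= => /andP[t'y yt].
  by rewrite (le_trans t'0)//= (le_lt_trans yt).
- move=> y /andP[t'y yt]; apply: (HL y _).1.
  by rewrite (le_trans t'0)//= (le_lt_trans yt).
have cT : 0 <= c < T by rewrite (le_trans t'0)//= (le_lt_trans ct).
exists c; first by rewrite tc.
rewrite E ler_wpM2r ?subr_ge0// ler_wpM2r ?(ltW (weight_gt0 cT r0))//.
by rewrite lerNr; have [] := HL c cT.
Qed.

Lemma weight_le t' t r : 0 <= t' -> t' <= t -> t < T -> 0 <= r ->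
  weight t' r <= weight t r.
Proof.
move=> t'0 t't tT r0; have [c /andP[tc ct] H] := weight_mean_value t'0 t't tT r0.
have cT : 0 <= c < T by rewrite (le_trans t'0)//= (le_lt_trans ct).
rewrite -subr_ge0; apply: le_trans H.
by rewrite !mulr_ge0 ?subr_ge0 ?(ltW hC) ?mass_ge0 ?(ltW (weight_gt0 cT r0)).
Qed.

Lemma mass_le t' t r : 0 <= t' -> t' <= t -> t < T -> 0 <= r ->
  mass t' r <= mass t r.
Proof.
move=> t'0 t't tT r0.
have t'T : 0 <= t' < T by rewrite t'0 (le_lt_trans t't).
have tT' : 0 <= t < T by rewrite (le_trans t'0).
apply: le_Rintegral => //; [exact: mass_density_integrable..|].
move=> s; rewrite /= in_itv/= andbT => rs; have s0 := le_lt_trans r0 rs.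
by rewrite ler_wpM2l ?oppr_ge0 ?z0_le0// weight_le// ltW.
Qed.

(** The mean value theorem puts the growth rate at an intermediate time; weight
    and mass being nondecreasing in time, it can be replaced by its value at t'. *)
Lemma weight_step t' t r : 0 <= t' -> t' <= t -> t < T -> 0 <= r ->
  weight t' r + C * (t - t') * (weight t' r * mass t' r) <= weight t r.
Proof.
move=> t'0 t't tT r0; have [c /andP[tc ct] H] := weight_mean_value t'0 t't tT r0.
have cT : 0 <= c < T by rewrite (le_trans t'0)//= (le_lt_trans ct).
have t'T : 0 <= t' < T by rewrite t'0 (le_lt_trans t't).
rewrite -lerBrDl; apply: le_trans H.
rewrite (_ : _ * _ = C * (mass t' r * weight t' r) * (t - t')); last by ring.
rewrite ler_wpM2r ?subr_ge0// -mulrA ler_wpM2l ?(ltW hC)// ler_pM ?mass_ge0//.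
- exact/ltW/weight_gt0.
- by rewrite mass_le// (le_lt_trans ct).
- by rewrite weight_le// (le_lt_trans ct).
Qed.

Lemma EFin_mass t r : 0 <= t < T -> 0 <= r ->
  (mass t r)%:E = (\int[mu]_(s in `]r, +oo[) (- z0 s * weight t s)%:E)%E.
Proof.
move=> tT r0; rewrite /mass /Rintegral fineK//.
by apply: integrable_fin_num => //; exact: mass_density_integrable.
Qed.

Lemma measurable_mass t : 0 <= t < T -> measurable_fun `](0 : R), +oo[ (mass t).
Proof.
move=> tT; apply: (@eq_measurable_fun _ _ _ _ _ (fun s => mass t (Num.max 0 s))).
  move=> s; rewrite inE/= in_itv/= andbT => s0.
  by rewrite max_r// ltW.
apply: nonincreasing_measurable => // x y xy.
have m0 z : 0 <= Num.max 0 z :> R by rewrite le_max lexx.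
have mxy : Num.max 0 x <= Num.max 0 y.
  by rewrite ge_max !le_max lexx xy orbT.
rewrite -lee_fin !EFin_mass//; apply: ge0_subset_integral => //.
- by apply/measurable_EFinP; exact: measurable_mass_density.
- move=> s; rewrite /= in_itv/= andbT lee_fin => xs.
  by apply: mass_density_ge0 => //; exact: le_lt_trans xs.
- by move=> s; rewrite /= !in_itv/= !andbT; exact: le_lt_trans.
Qed.

(** Integrate [weight_step] against - z0. The product of the mass density with the
    mass of its tail integrates to half of the square of the total mass. *)
Lemma mass_step t' t : 0 <= t' -> t' <= t -> t < T ->
  mass t' 0 + C / 2 * (t - t') * mass t' 0 ^+ 2 <= mass t 0.
Proof.
move=> t'0 t't tT.
have t'T : 0 <= t' < T by rewrite t'0 (le_lt_trans t't).
have tT' : 0 <= t < T by rewrite (le_trans t'0).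
pose f s := - z0 s * weight t' s.
have mf : measurable_fun `](0 : R), +oo[ f by exact: measurable_mass_density.
have f0 s : 0 < s -> 0 <= f s by exact: mass_density_ge0.
have mfm : measurable_fun `](0 : R), +oo[ (fun s => f s * mass t' s).
  by apply: measurable_funM => //; exact: measurable_mass.
have fm0 s : 0 < s -> 0 <= f s * mass t' s.
  by move=> s0; rewrite mulr_ge0 ?f0// mass_ge0// ltW.
have tail := sqr_integral_le_tail mf f0.
have k0 : 0 <= C * (t - t') by rewrite mulr_ge0 ?subr_ge0// ltW.
pose I := (\int[mu]_(s in `]0%R, +oo[) (f s * mass t' s)%:E)%E.
have {}tail : ((mass t' 0 ^+ 2)%:E <= 2%:E * I)%E.
  rewrite expr2 EFinM EFin_mass//; apply: (le_trans tail).
  rewrite le_eqVlt; apply/orP; left; apply/eqP; congr (_ * _)%E.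
  apply: eq_integral => s; rewrite inE/= in_itv/= andbT => s0.
  by rewrite [in RHS]EFinM EFin_mass// ltW.
have main : ((mass t' 0)%:E + (C * (t - t'))%:E * I <= (mass t 0)%:E)%E.
  rewrite !EFin_mass// /I -ge0_integralZl//; last 2 first.
  - by apply/measurable_EFinP.
  - by move=> s; rewrite /= in_itv/= andbT lee_fin; exact: fm0.
  rewrite -ge0_integralD//; last 4 first.
  - by move=> s; rewrite /= in_itv/= andbT lee_fin; exact: f0.
  - exact/measurable_EFinP.
  - move=> s; rewrite /= in_itv/= andbT -EFinM lee_fin => s0.
    by rewrite mulr_ge0// fm0.
  - by apply/measurable_EFinP; exact: measurable_funM.
  apply: ge0_le_integral => //.
  - move=> s; rewrite /= in_itv/= andbT -EFinM -EFinD lee_fin => s0.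
    by rewrite addr_ge0 ?f0// mulr_ge0// fm0.
  - apply/measurable_EFinP; apply: measurable_funD => //.
    exact: measurable_funM.
  - apply/measurable_EFinP; exact: measurable_mass_density.
  - move=> s; rewrite /= in_itv/= andbT -EFinM -EFinD lee_fin => s0.
    rewrite (_ : _ + _ = - z0 s * (weight t' s +
      C * (t - t') * (weight t' s * mass t' s))); last by rewrite /f; ring.
    by rewrite ler_wpM2l ?oppr_ge0 ?z0_le0// weight_step// ltW.
rewrite -lee_fin EFinD; apply: le_trans main; rewrite leeD2l//.
rewrite (_ : _ * _ = C * (t - t') * (2^-1 * mass t' 0 ^+ 2)); last by ring.
rewrite EFinM lee_wpmul2l ?lee_fin// EFinM.
rewrite (_ : I = (2^-1)%:E * (2%:E * I))%E; last first.
  by rewrite muleA -EFinM mulVf ?mul1e.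
by rewrite lee_wpmul2l ?lee_fin.
Qed.

Lemma system_time_bound : 0 < mass 0 0 -> T <= 2 / (C / 2 * mass 0 0).
Proof.
move=> m0; apply: (@riccati_blowup _ (mass^~ 0)) => //; first by rewrite divr_gt0.
by move=> t' t ? ? ?; exact: mass_step.
Qed.

(** A nonpositive momentum and a positive kernel give a nonpositive velocity. At
    r = 0 the sign of the kernel is not known, but there gamma is constant. *)
Lemma gamma_inward t r : 0 <= t < T -> 0 <= r ->
  exists2 v, has_deriv_within `[0, T[ (gamma^~ r) t v & v <= 0.
Proof.
move=> tT r0; have [v [dv hv]] := sys_gamma_eq S tT r0; exists v => //.
move: r0; rewrite le_eqVlt => /predU1P[r0|r0].
  move: dv; rewrite -r0 => dv; suff -> : v = 0 by [].
  apply: (has_deriv_within_unique (fun d d0 => itvco_limit_point tT d0) dv).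
  have tT' : `[0, T[%classic t by rewrite /= in_itv.
  apply: has_deriv_within_eq (has_deriv_within_cst _ 0 t) => // y.
  by rewrite inE/= in_itv/= => yT; rewrite (sf_gamma0 SF).
have [] := is_split_integral_le (k := fun=> 0) _ _ _ hv.
- move=> s /andP[s0 sr]; rewrite mulr_ge0_le0 ?z0_le0// divr_ge0//.
    apply/ltW/hdelta_pos; rewrite (gamma_gt0 SF)//= ltW// (gamma_lt SF)// ltW//.
  by rewrite ltW// (sf_rho_gt0 SF)// ltW.
- move=> s rs; have s0 := lt_trans r0 rs.
  rewrite lexx/= oppr_ge0 mulr_ge0_le0 ?z0_le0// divr_ge0//.
    apply/ltW/hdelta_pos; rewrite (gamma_gt0 SF)//= ltW// (gamma_lt SF)// ltW//.
  by rewrite ltW// (sf_rho_gt0 SF)// ltW.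
- exact: measurable_cst.
by move=> _; rewrite Rintegral_cst// mul0r oppr0.
Qed.

Lemma gamma_nonincreasing t' t r : 0 <= t' -> t' <= t -> t < T -> 0 <= r ->
  gamma t r <= gamma t' r.
Proof.
move=> t'0 t't tT r0.
have [dv Hdv] : {dv : R -> R & forall y, 0 <= y < T ->
    has_deriv_within `[0, T[ (gamma^~ r) y (dv y) /\ dv y <= 0}.
  apply: (@choice _ _ (fun y v => 0 <= y < T ->
    has_deriv_within `[0, T[ (gamma^~ r) y v /\ v <= 0)) => y.
  case: (pselect (0 <= y < T)) => [yT|?]; last by exists 0.
  by have [v ? ?] := gamma_inward yT r0; exists v.
have [| |c /andP[tc ct] E] := @mean_value_within _ `[0, T[%classic (gamma^~ r)
    dv t' t _ t't.
- move=> y; rewrite /= !in_itv/= => /andP[t'y yt].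
  by rewrite (le_trans t'0)//= (le_lt_trans yt).
- move=> y /andP[t'y yt]; apply: (Hdv y _).1.
  by rewrite (le_trans t'0)//= (le_lt_trans yt).
have cT : 0 <= c < T by rewrite (le_trans t'0)//= (le_lt_trans ct).
by rewrite -subr_le0 E mulr_le0_ge0 ?subr_ge0//; have [] := Hdv c cT.
Qed.

End one_solution.
End dynamics.

(** * Maximal solutions *)

Section maximal_solution.
Context {R : realType}.
Local Notation mu := (@lebesgue_measure R).
Variables (n : nat) (delta : R -> R -> R) (omega0 : R -> R).
Implicit Types (t r s T : R) (gamma rho : R -> R -> R).
Local Notation z0 := (momentum_density n omega0).

Lemma has_deriv_within_widen T1 T (f : R -> R) t l : t < T1 -> T1 <= T ->
  has_deriv_within `[0, T1[ f t l -> has_deriv_within `[0, T[ f t l.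
Proof.
move=> tT1 T1T /has_deriv_withinP H; apply/has_deriv_withinP => e /H[d d0 Hd].
exists (Num.min d (T1 - t)); first by rewrite lt_min d0 subr_gt0.
move=> y; rewrite /= in_itv/= => /andP[y0 yT]; rewrite lt_min => /andP[yd yt].
apply: Hd => //; rewrite /= in_itv/= y0/=.
by move: yt; rewrite ltr_norml => /andP[_]; rewrite ltrD2r.
Qed.

(** The value of rho_t / rho as a function of gamma and rho alone, so that the
    time derivatives of solutions which agree can be glued. *)
Definition stretch_rate (G P : R -> R) (r : R) : R :=
  \int[mu]_(s in `]0, r[) (partial2 delta (G s) (G r) / P s * z0 s) +
  \int[mu]_(s in `]r, +oo[) (partial1 delta (G r) (G s) / P s * z0 s).

(** Every clause of the system concerns only times near a given t. *)
Lemma system_solution_glue T gamma rho : 0 < T ->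
  (forall t, 0 <= t < T -> exists T1 gamma1 rho1, [/\ t < T1 <= T,
     system_solution n delta omega0 T1 gamma1 rho1 &
     extends T1 gamma1 rho1 gamma rho]) ->
  system_solution n delta omega0 T gamma rho.
Proof.
move=> T0 H.
have zT : 0 <= (0 : R) < T by rewrite lexx.
split.
- move=> r r0; have [T1 [g1 [p1 [/andP[tT1 _] S1 E1]]]] := H 0 zT.
  have [|-> _] := E1 0 r _ r0; first by rewrite lexx.
  exact: (sys_gamma_init S1).
- move=> r r0; have [T1 [g1 [p1 [/andP[tT1 _] S1 E1]]]] := H 0 zT.
  have [|_ ->] := E1 0 r _ r0; first by rewrite lexx.
  exact: (sys_rho_init S1).
- move=> t /[dup] tT /H [T1 [g1 [p1 [/andP[tT1 _] S1 E1]]]].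
  have tT1' : 0 <= t < T1 by move: tT => /andP[-> _].
  have [/subspace_continuousP pc [a [b [ab Hab]]]] := sys_phase S1 tT1'.
  split; last first.
    exists a, b; split => // r r0.
    by have [_ ->] := E1 t r tT1' r0; exact: Hab.
  apply/subspace_continuousP => r r0.
  have r0' : 0 <= r by move: r0; rewrite /= in_itv/= andbT.
  suff : rho t @ within `[0, +oo[ (nbhs (r : R)) --> rho t r by [].
  apply/within_cvgP => e e0; have [_ ->] := E1 t r tT1' r0'.
  have /within_cvgP/(_ e e0)[d d0 Hd] := pc r r0.
  exists d => // y y0 yr.
  have y0' : 0 <= y by move: y0; rewrite /= in_itv/= andbT.
  by have [_ ->] := E1 t y tT1' y0'; exact: Hd.
- move=> t /[dup] tT /H [T1 [g1 [p1 [/andP[tT1 _] S1 E1]]]].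
  have tT1' : 0 <= t < T1 by move: tT => /andP[-> _].
  have [-> _] := E1 t 0 tT1' (lexx _); exact: (sys_gamma0 S1).
- move=> t r /[dup] tT /H [T1 [g1 [p1 [/andP[tT1 _] S1 E1]]]] r0.
  have tT1' : 0 <= t < T1 by move: tT => /andP[-> _].
  have [_ ->] := E1 t r tT1' r0.
  apply: has_deriv_within_eq (sys_gamma_rho S1 tT1' r0).
    by rewrite /= in_itv/= r0.
  by move=> y; rewrite inE/= in_itv/= andbT => y0; have [->] := E1 t y tT1' y0.
- move=> t r /[dup] tT /H [T1 [g1 [p1 [/andP[tT1 T1T] S1 E1]]]] r0.
  have tT1' : 0 <= t < T1 by move: tT => /andP[-> _].
  have [v [dv hv]] := sys_gamma_eq S1 tT1' r0; exists v; split.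
    apply: has_deriv_within_widen tT1 T1T _.
    apply: has_deriv_within_eq dv; first by rewrite /= in_itv.
    by move=> y; rewrite inE/= in_itv/= => y0; have [->] := E1 y r y0 r0.
  have [-> _] := E1 t r tT1' r0; apply: is_split_integral_eq hv.
    by move=> s /andP[/ltW s0 _]; have [-> ->] := E1 t s tT1' s0.
  by move=> s rs; have [|-> ->] := E1 t s tT1' _; first exact: le_trans r0 (ltW rs).
exists (fun t r => rho t r * stretch_rate (gamma t) (rho t) r).
move=> t /[dup] tT /H [T1 [g1 [p1 [/andP[tT1 T1T] S1 E1]]]].
have tT1' : 0 <= t < T1 by move: tT => /andP[-> _].
have [h Hh] := sys_rho_eq S1.
have rate y r : 0 <= y < T1 -> 0 <= r -> exists2 w, 
    h y r = rho y r * w & is_split_integral r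
            (fun s => partial2 delta (gamma y s) (gamma y r) / rho y s * z0 s)
            (fun s => partial1 delta (gamma y r) (gamma y s) / rho y s * z0 s) w.
  move=> yT1 r0; have [_ _ /(_ r r0)[w [hE hw]]] := Hh y yT1.
  have [gE rE] := E1 y r yT1 r0; exists w; first by rewrite rE.
  rewrite gE; apply: is_split_integral_eq hw.
    by move=> s /andP[/ltW s0 _]; have [-> ->] := E1 y s yT1 s0.
  by move=> s rs; have [|-> ->] := E1 y s yT1 _; first exact: le_trans r0 (ltW rs).
have hE y r : 0 <= y < T1 -> 0 <= r ->
    h y r = rho y r * stretch_rate (gamma y) (rho y) r.
  move=> yT1 r0; have [w -> hw] := rate y r yT1 r0; congr (_ * _).
  by have /is_split_integral_open[_ _ ->] := hw.
have [q hc _] := Hh t tT1'.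
split.
- apply/uniform_quotientP => e e0.
  have [d d0 Hd] := (uniform_quotientP _ _ _ _ _).1 q e e0.
  exists (Num.min d (T1 - t)); first by rewrite lt_min d0 subr_gt0.
  move=> y; rewrite /= in_itv/= => /andP[y0 yT] yt; rewrite lt_min => /andP[yd ytT].
  have yT1 : 0 <= y < T1.
    by rewrite y0/=; move: ytT; rewrite ltr_norml => /andP[_]; rewrite ltrD2r.
  move=> r r0; have r0' : 0 <= r by move: r0; rewrite /= in_itv/= andbT.
  have [_ ->] := E1 y r yT1 r0'; rewrite -hE//; have [_ ->] := E1 t r tT1' r0'.
  by apply: Hd => //; rewrite /= in_itv.
- apply/(@uniform_within_nbhsP R _ _
    (fun t r => rho t r * stretch_rate (gamma t) (rho t) r)) => e e0.
  have [d d0 Hd] := (uniform_within_nbhsP _ _ _ _).1 hc e e0.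
  exists (Num.min d (T1 - t)); first by rewrite lt_min d0 subr_gt0.
  move=> y; rewrite /= in_itv/= => /andP[y0 yT]; rewrite lt_min => /andP[yd ytT].
  have yT1 : 0 <= y < T1.
    by rewrite y0/=; move: ytT; rewrite ltr_norml => /andP[_]; rewrite ltrD2r.
  move=> r r0; have r0' : 0 <= r by move: r0; rewrite /= in_itv/= andbT.
  by rewrite -!hE//; apply: Hd => //; rewrite /= in_itv.
- move=> r r0; have [w hw1 hw2] := rate t r tT1' r0.
  by exists w; split => //; rewrite -hE.
Qed.

Lemma extends_trans T gamma rho T' gamma' rho' gamma'' rho'' : T <= T' ->
  extends T gamma rho gamma' rho' -> extends T' gamma' rho' gamma'' rho'' ->
  extends T gamma rho gamma'' rho''.
Proof.
move=> TT E E' t r /andP[t0 tT] r0.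
have [|-> ->] := E' t r _ r0; first by rewrite t0 (lt_le_trans tT).
by apply: E => //; rewrite t0.
Qed.

(** Zorn's lemma for the order of extension. A chain is bounded by the solution
    glued from its members, which lives up to the supremum of their lifetimes;
    this supremum is finite by the uniform bound B. *)
Lemma maximal_solution_exists (B T0 : R) gamma0 rho0 :
  (forall T gamma rho, 0 < T -> system_solution n delta omega0 T gamma rho ->
     T <= B) ->
  0 < T0 -> system_solution n delta omega0 T0 gamma0 rho0 ->
  exists T gamma rho, [/\ T0 <= T, system_solution n delta omega0 T gamma rho,
    extends T0 gamma0 rho0 gamma rho &
    forall T' gamma' rho', T < T' ->
      system_solution n delta omega0 T' gamma' rho' ->
      ~ extends T gamma rho gamma' rho'].
Proof.
move=> bound T00 S0.
pose good (p : R * ((R -> R -> R) * (R -> R -> R))) :=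
  [/\ T0 <= p.1, system_solution n delta omega0 p.1 p.2.1 p.2.2 &
    extends T0 gamma0 rho0 p.2.1 p.2.2].
pose X := {p | good p}.
pose le (p q : X) := (sval p).1 <= (sval q).1 /\
  extends (sval p).1 (sval p).2.1 (sval p).2.2 (sval q).2.1 (sval q).2.2.
have g0 : good (T0, (gamma0, rho0)) by split => //= t r _ _.
pose x0 : X := exist _ _ g0.
have [| | |[[T [g p]] [/= T0T S E]] max] :=
  @ZL_preorder X x0 (fun p q => `[< le p q >]).
- by move=> x; apply/asboolP; split => // t r _ _.
- move=> y x z /asboolP[xy Exy] /asboolP[yz Eyz]; apply/asboolP.
  by split; [exact: le_trans yz|exact: extends_trans Eyz].
- move=> A totA; have [[a Aa]|noA] := pselect (exists a, A a); last first.
    by exists x0 => s As; exfalso; apply: noA; exists s.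
  pose I := [set (sval q).1 | q in A].
  have hsI : has_sup I.
    split; first by exists (sval a).1, a.
    exists B => _ [q Aq <-]; have [Tq Sq _] := svalP q.
    by apply: bound Sq; exact: lt_le_trans Tq.
  have le_sup q : A q -> (sval q).1 <= sup I.
    by move=> Aq; apply: sup_ubound; [exact: hsI.2|exists q].
  have [pick pickP] : {pick : R -> X & forall t, (exists q, A q /\ t < (sval q).1) ->
      A (pick t) /\ t < (sval (pick t)).1}.
    apply: (@choice _ _ (fun t p => (exists q, A q /\ t < (sval q).1) ->
      A p /\ t < (sval p).1)) => t.
    by have [[q Hq]|?] := pselect (exists q, A q /\ t < (sval q).1);
      [exists q|exists x0].
  pose G t r := (sval (pick t)).2.1 t r.
  pose P t r := (sval (pick t)).2.2 t r.
  have extG q : A q -> extends (sval q).1 (sval q).2.1 (sval q).2.2 G P.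
    move=> Aq t r /andP[t0 tq] r0; rewrite /G /P.
    have [|Ay ty] := pickP t; [by exists q|move: (pick t) Ay ty => y Ay ty].
    have [/asboolP[_ /(_ t r)]|/asboolP[_ /(_ t r)]] := totA _ _ Aq Ay.
      by rewrite t0 tq => /(_ isT r0).
    by rewrite t0 ty => /(_ isT r0)[-> ->].
  have T0s : T0 <= sup I.
    by apply: le_trans (le_sup a Aa); have [] := svalP a.
  have good_s : good (sup I, (G, P)).
    split => //=.
      apply: system_solution_glue; first exact: lt_le_trans T0s.
      move=> t /andP[t0 ts].
      have st0 : 0 < sup I - t by rewrite subr_gt0.
      have [_ [q Aq <-] tq] := sup_adherent st0 hsI.
      move: tq; rewrite subKr => tq; have [_ Sq _] := svalP q.
      exists (sval q).1, (sval q).2.1, (sval q).2.2; split => //; last exact: extG.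
      by rewrite tq le_sup.
    have [Ta Sa Ea] := svalP a.
    exact: extends_trans Ta Ea (extG a Aa).
  exists (exist _ _ good_s) => q Aq; apply/asboolP; split => /=; first exact: le_sup.
  exact: extG.
exists T, g, p; split => // T' g' p' TT' S' E'.
have g'g : good (T', (g', p')).
  split => //=; first exact: le_trans (ltW TT').
  exact: extends_trans T0T E E'.
have le1 : `[< le (exist good (T, (g, p)) (And3 T0T S E))
    (exist good (T', (g', p')) g'g) >].
  by apply/asboolP; split => //; exact: ltW.
have /asboolP[/=] := max _ le1.
by rewrite leNgt TT'.
Qed.

End maximal_solution.

(** * The initial momentum *)

Section initial_data.
Context {R : realType}.
Local Notation mu := (@lebesgue_measure R).
Variables (n : nat) (delta : R -> R -> R) (omega0 u0 : R -> R).
Hypotheses (hdelta_smooth : smooth_on (@wedge R) delta)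
  (hdelta_pos : forall r s, 0 < r <= s -> 0 < delta r s)
  (hu0 : forall r, 0 < r -> kernel_formula n delta omega0 r (u0 r)).
Local Notation z0 := (momentum_density n omega0).

Lemma kernel_continuous r s : 0 < r <= s -> {for s, continuous (delta r)}.
Proof.
move=> /andP[r0 rs]; have [U [_ DU /(_ [::])H]] := hdelta_smooth.
have [|_ _ /derivable1_diffP/differentiable_continuous//] := H (r, s).
apply: DU; split => /=; first by rewrite (ltW r0).
by move=> [r00]; rewrite r00 ltxx in r0.
Qed.

(** On [r, oo[ the formula for u0 r makes the product of delta r and z0 measurable,
    and delta r is continuous and positive there; then r tends to 0. *)
Lemma measurable_momentum_density : measurable_fun `](0 : R), +oo[ z0.
Proof.
have -> : `](0 : R), +oo[%classic = \bigcup_k `[(k.+1%:R)^-1 : R, +oo[%classic.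
  apply/seteqP; split => x /=; rewrite in_itv/= andbT.
    move=> x0; exists (Num.bound x^-1) => //=; rewrite in_itv/= andbT.
    rewrite invf_ple ?posrE//; apply: (le_trans (ler_norm _)).
    apply: ltW; apply: lt_le_trans (archi_boundP (normr_ge0 _)) _.
    by rewrite ger0_norm ?invr_ge0 ?(ltW x0)// ler_nat.
  by move=> [k _ /=]; rewrite in_itv/= andbT; apply: lt_le_trans; rewrite invr_gt0.
apply/measurable_fun_bigcup => // k.
set r : R := k.+1%:R^-1; have r0 : 0 < r by rewrite invr_gt0.
have [_ /integrableP[/measurable_EFinP mg _] _] := hu0 r0.
apply: (@eq_measurable_fun _ _ _ _ _ (fun s => (delta r s)^-1 *
    (delta r s * (s ^+ n.-1 * omega0 s)))).
  move=> s; rewrite inE/= in_itv/= andbT => rs.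
  by rewrite mulKf// gt_eqF// hdelta_pos// r0.
apply: measurable_funM => //.
apply: subspace_continuous_measurable_fun => //.
apply/subspace_continuousP => s /=; rewrite in_itv/= andbT => rs.
have rs' : 0 < r <= s by rewrite r0.
apply: cvgV; first by rewrite gt_eqF// hdelta_pos.
by apply: cvg_within_filter; exact: kernel_continuous.
Qed.

(** Otherwise z0 vanishes almost everywhere, and so does u0 by its integral
    formula. *)
Lemma momentum_density_neq0 (k : R -> R) : (exists2 r, 0 < r & u0 r <> 0) ->
  (forall s, 0 < s -> 0 <= k s) ->
  (forall s, 0 < s -> k s = 0 -> z0 s = 0) ->
  mu.-integrable `](0 : R), +oo[ (EFin \o k) ->
  0 < \int[mu]_(s in `](0 : R), +oo[) k s.
Proof.
move=> [r r0 ur] k0 kz ki; rewrite lt0r; apply/andP; split; last first.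
  by apply: Rintegral_ge0 => s; rewrite /= in_itv/= andbT; exact: k0.
apply/eqP => I0; apply: ur.
have E0 : (\int[mu]_(s in `](0%R : R), +oo[) `|(EFin \o k) s|)%E = 0%R.
  transitivity (\int[mu]_(s in `](0%R : R), +oo[) (k s)%:E)%E.
    apply: eq_integral => s; rewrite inE/= in_itv/= andbT => s0.
    by rewrite ger0_norm// k0.
  by rewrite -[LHS]fineK; [congr EFin|exact: integrable_fin_num].
have ae0 := (ae_eq_integral_abs mu (measurable_itv _) (measurable_int mu ki)).1 E0.
have vanish (D : set R) (c : R -> R) : measurable D -> D `<=` `](0 : R), +oo[ ->
    mu.-integrable D (EFin \o (fun s => c s * z0 s)) ->
    \int[mu]_(s in D) (c s * z0 s) = 0.
  move=> mD sD ci; rewrite /Rintegral.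
  rewrite (@ae_eq_integral _ _ _ mu D (cst 0%E))//.
  - by rewrite integral0.
  - exact: measurable_int ci.
  - apply: filterS ae0 => s H Ds /=.
    have s0 := sD _ Ds; have [ks] := H s0.
    by rewrite kz ?mulr0//; move: s0; rewrite /= in_itv/= andbT.
have /is_split_integral_open[fi gi ->] := hu0 r0.
rewrite (vanish `]0, r[%classic)// ?add0r.
  rewrite (vanish `]r, +oo[%classic)//.
  by move=> s; rewrite /= !in_itv/= !andbT; exact: lt_trans.
by move=> s; rewrite /= !in_itv/= andbT => /andP[].
Qed.

End initial_data.

(** * Substitution by the flow *)

Section half_line_substitution.
Context {R : realType}.
Local Notation mu := (@lebesgue_measure R).
Variables (G P eta : R -> R) (a : R).
Hypotheses (G0 : G 0 = 0)
  (dG : forall r : R, 0 <= r -> has_deriv_within `[0, +oo[ G r (P r))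
  (Pc : forall r : R, 0 <= r -> P @ within `[0, +oo[ (nbhs r) --> P r)
  (a0 : 0 < a) (Pa : forall r : R, 0 <= r -> a <= P r)
  (etaP : forall x : R, 0 <= x -> 0 <= eta x /\ G (eta x) = x)
  (etaG : forall r : R, 0 <= r -> eta (G r) = r)
  (Gge0 : forall r : R, 0 <= r -> 0 <= G r).

(** The flow extended linearly to r < 0, so that it is a C^1 diffeomorphism of
    the whole line. *)
Let Gx x := if 0 <= x then G x else P 0 * x.
Let Px x := P (Num.max 0 x).
Let etax x := if 0 <= x then eta x else x / P 0.

Let P0 : 0 < P 0. Proof. exact: lt_le_trans (Pa _). Qed.

Let dGx x : is_derive x (1 : R) Gx (Px x).
Proof.
apply: (@has_deriv_within_is_derive _ setT); first exact: filterT.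
apply/has_deriv_withinP => e e0; have [x0|x0] := leP 0 x; last first.
  exists (- x); first by rewrite oppr_gt0.
  move=> y _; rewrite ltr_norml => /andP[_ yx].
  have y0 : y < 0 by lra.
  rewrite /Gx /Px (leNgt 0 y) y0 (leNgt 0 x) x0/= max_l ?(ltW x0)//.
  by rewrite -mulrBr subrr normr0 mulr_ge0// ltW.
have [d d0 Hd] := (has_deriv_withinP _ _ _ _).1 (dG x0) e e0.
exists (if x == 0 then d else Num.min d x).
  by case: ifPn => // xn0; rewrite lt_min d0 lt_neqAle eq_sym xn0.
move=> y _ yx; rewrite /Gx /Px x0 max_r//.
have [y0|y0] := leP 0 y.
  apply: Hd; first by rewrite /= in_itv/= y0.
  by apply: lt_le_trans yx _; case: ifPn => // _; rewrite ge_min lexx.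
have x00 : x = 0.
  apply/eqP/negPn/negP => xn0; move: yx; rewrite (negbTE xn0) lt_min => /andP[_].
  by rewrite ltr_norml => /andP[]; lra.
by rewrite x00 G0 !subr0 subrr normr0 mulr_ge0// ltW.
Qed.

Let cPx : continuous Px.
Proof.
move=> x; apply/cvgrPdist_lt => e e0.
have m0 : 0 <= Num.max 0 x by rewrite le_max lexx.
have /within_cvgP/(_ e e0)[d d0 Hd] := Pc m0.
exists d => //= y yx; rewrite distrC; apply: Hd.
  by rewrite /= in_itv/= andbT le_max lexx.
move: yx; rewrite distrC; apply: le_lt_trans.
have [x0|x0] := leP 0 x; have [y0|y0] := leP 0 y => //; rewrite ?subrr ?normr0//.
  by rewrite subr0 ger0_norm// ger0_norm; lra.
by rewrite sub0r normrN ger0_norm// ltr0_norm; lra.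
Qed.

Let Px_ge x : a <= Px x. Proof. by apply: Pa; rewrite le_max lexx. Qed.

Let GxK : cancel Gx etax.
Proof.
move=> x; rewrite /Gx /etax; have [x0|x0] := leP 0 x; first by rewrite Gge0// etaG.
by rewrite pmulr_rge0// leNgt x0/= mulrC mulKf// gt_eqF.
Qed.

Let etaxK : cancel etax Gx.
Proof.
move=> x; rewrite /Gx /etax; have [x0|x0] := leP 0 x.
  by have [-> ->] := etaP x0.
by rewrite pmulr_lge0 ?invr_gt0// leNgt x0/= mulrC divfK// gt_eqF.
Qed.

Let etax_cont : continuous etax.
Proof.
have cGx : continuous Gx.
  move=> z; apply/differentiable_continuous/derivable1_diffP.
  by case: (dGx z).
have lip x y : x <= y -> a * `|etax y - etax x| <= `|y - x|.
  move=> xy; have [l|l] := leP (etax x) (etax y).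
    have [|c _ E] := @MVT_segment R Gx Px _ _ l (fun z _ => dGx z).
      exact: continuous_subspaceT.
    rewrite -{2}(etaxK y) -{2}(etaxK x) E normrM ler_wpM2r//.
    by rewrite ger0_norm ?(le_trans (ltW a0)).
  have [|c _ E] := @MVT_segment R Gx Px _ _ (ltW l) (fun z _ => dGx z).
    exact: continuous_subspaceT.
  rewrite distrC (distrC y) -{2}(etaxK y) -{2}(etaxK x) E normrM ler_wpM2r//.
  by rewrite ger0_norm ?(le_trans (ltW a0)).
move=> x; apply/cvgrPdist_lt => e e0.
exists (a * e) => /=; first by rewrite mulr_gt0.
move=> y xy; rewrite -(ltr_pM2l a0); apply: le_lt_trans xy.
have [l|/ltW l] := leP x y; last exact: lip.
by rewrite distrC (distrC x); exact: lip.
Qed.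

Lemma half_line_substitution (D D' : set R) (k : R -> R) :
  measurable D -> D `<=` `]0, +oo[ ->
  (forall s, D' s <-> 0 < s /\ D (eta s)) ->
  measurable_fun D k -> (forall y, D y -> 0 <= k y) ->
  [/\ measurable D', measurable_fun D' (k \o eta) &
  (\int[mu]_(s in D') (k (eta s))%:E = \int[mu]_(y in D) (k y * P y)%:E)%E].
Proof.
move=> mD D0 D'E mk k0.
have gt0 s : D' s -> 0 < s by move=> /D'E[].
have D'x : D' = etax @^-1` D.
  apply/seteqP; split => s.
    by move=> /D'E[s0 Ds]; rewrite /= /etax ltW.
  move=> Ds; have := D0 _ Ds; rewrite /= in_itv/= andbT => es0.
  move: Ds es0; rewrite /= /etax; have [s0|s0] := leP 0 s; last first.
    by rewrite pmulr_lgt0 ?invr_gt0// ltNge (ltW s0).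
  move=> Ds es; apply/D'E; split => //.
  rewrite lt_neqAle s0 andbT; apply/eqP => s00; move: es.
  by have := etaG (lexx 0); rewrite -s00 G0 => ->; rewrite ltxx.
have metax : measurable_fun setT etax by exact: continuous_measurable_fun.
have mD' : measurable D'.
  by rewrite D'x -[X in measurable X]setTI; exact: metax.
have kE s : D' s -> k (eta s) = k (etax s) by move=> /gt0/ltW s0; rewrite /etax s0.
split => //.
- apply: (@eq_measurable_fun _ _ _ _ _ (k \o etax)).
    by move=> s; rewrite inE => /kE.
  apply: (@measurable_comp _ _ _ _ _ _ D) => //.
    by move=> _ [s + <-]; rewrite D'x.
  exact: measurable_funS metax.
- transitivity (\int[mu]_(s in etax @^-1` D) (k (etax s))%:E)%E.
    by rewrite D'x; apply: eq_integral => s; rewrite inE -D'x => /kE ->.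
  have Px0 x : 0 < Px x by exact: lt_le_trans (Px_ge x).
  have mkE : measurable_fun (D : set (measurableTypeR R)) (EFin \o k).
    exact/measurable_EFinP.
  have kE0 : {in D, forall y, (0 <= (EFin \o k) y)%E}.
    by move=> y; rewrite inE lee_fin; exact: k0.
  transitivity (\int[mu]_(y in D) ((EFin \o k) y * (Px y)%:E))%E.
    exact: (ge0_integral_substitution cPx Px0 dGx GxK etaxK etax_cont mD mkE kE0).
  apply: eq_integral => y; rewrite inE => /D0; rewrite /= in_itv/= andbT => y0.
  by rewrite EFinM /Px max_r// ltW.
Qed.

(** F has a constant sign, so the identity for - F carries the integrability of F
    over to the transformed integrand. *)
Lemma half_line_Rintegral (D D' : set R) (F : R -> R) :
  measurable D -> D `<=` `]0, +oo[ ->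
  (forall s, D' s <-> 0 < s /\ D (eta s)) ->
  mu.-integrable D (EFin \o F) -> (forall y, D y -> F y <= 0) ->
  mu.-integrable D' (EFin \o (fun s => F (eta s) / P (eta s))) /\
  \int[mu]_(s in D') (F (eta s) / P (eta s)) = \int[mu]_(y in D) F y.
Proof.
move=> mD D0 D'E Fi F0.
have PD y : D y -> 0 < P y.
  by move=> /D0; rewrite /= in_itv/= andbT => /ltW/Pa; exact: lt_le_trans.
pose k y := - (F y / P y).
have k0 y : D y -> 0 <= k y.
  by move=> Dy; rewrite oppr_ge0 mulr_le0_ge0 ?F0// invr_ge0 ltW// PD.
have mPV : measurable_fun D (fun y => (P y)^-1).
  apply: (@measurable_funS _ _ _ _ `[(0 : R), +oo[%classic) => //.
    by move=> y /D0; rewrite /= !in_itv/= !andbT => /ltW.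
  apply: subspace_continuous_measurable_fun => //.
  apply/subspace_continuousP => s /=; rewrite in_itv/= andbT => s0.
  by apply: cvgV; [rewrite gt_eqF// (lt_le_trans a0)// Pa|exact: Pc].
have mF : measurable_fun D F by apply/measurable_EFinP; exact: measurable_int Fi.
have mk : measurable_fun D k.
  by apply: measurableT_comp => //; exact: measurable_funM.
have [mD' mke kE] := half_line_substitution mD D0 D'E mk k0.
have DE s : D' s -> D (eta s) by move=> /D'E[].
have E : (\int[mu]_(s in D') (k (eta s))%:E = \int[mu]_(y in D) (- F y)%:E)%E.
  rewrite kE; apply: eq_integral => y; rewrite inE => Dy.
  by rewrite /k mulNr divfK// gt_eqF// PD.
have NFi : mu.-integrable D (EFin \o (fun y => -1 * F y)).
  exact: integrable_EFinZl.
have ki : mu.-integrable D' (EFin \o (k \o eta)).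
  apply/integrableP; split; first exact/measurable_EFinP.
  have -> : (\int[mu]_(s in D') `|(EFin \o (k \o eta)) s| =
      \int[mu]_(y in D) ((EFin \o (fun y => (-1 : R)%R * F y)%R) y))%E.
    rewrite [RHS](_ : _ = \int[mu]_(y in D) (- F y)%:E)%E; last first.
      by apply: eq_integral => y _; rewrite /= mulN1r.
    rewrite -E; apply: eq_integral => s; rewrite inE => /DE/k0 ?.
    by rewrite /= ger0_norm.
  have := integrable_fin_num (mD : measurable (D : set (measurableTypeR R))) NFi.
  by rewrite fin_num_abs => /(le_lt_trans (lee_abs _)).
split.
  apply: eq_integrable (integrable_EFinZl (-1) mD' ki) => // s _.
  by rewrite /= mulN1r opprK.
transitivity (- \int[mu]_(s in D') k (eta s)).
  rewrite -mulN1r -RintegralZl//; apply: eq_Rintegral => s _.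
  by rewrite mulN1r opprK.
rewrite /Rintegral E -/(Rintegral mu D (fun y => - F y)).
rewrite -mulN1r -RintegralZl//.
  by apply: eq_Rintegral => s _; rewrite mulN1r opprK.
by apply: eq_integrable NFi => // s _; rewrite /= mulN1r.
Qed.

End half_line_substitution.

(** * The classical solution carried by the flow *)

Section classical_solution.
Context {R : realType}.
Local Notation mu := (@lebesgue_measure R).
Variables (n : nat) (delta : R -> R -> R) (u0 omega0 : R -> R).
Hypotheses (homega0 : forall r, 0 < r -> omega0 r <= 0)
  (hdelta_pos : forall r s, 0 < r <= s -> 0 < delta r s)
  (hu0 : forall r, 0 < r -> kernel_formula n delta omega0 r (u0 r)).
Variables (T : R) (gamma rho u : R -> R -> R).
Hypotheses (T0 : 0 < T) (S : system_solution n delta omega0 T gamma rho)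
  (hu : forall t r, 0 <= t < T -> 0 <= r ->
     has_deriv_within `[0, T[ (gamma^~ r) t (u t (gamma t r))).
Implicit Types (t r s x : R).
Local Notation z0 := (momentum_density n omega0).
Local Notation eta := (inverse_flow gamma).

Lemma system_regular_flow : exists h, regular_flow T gamma rho h u.
Proof.
have [h H] := sys_rho_eq S; exists h; split => //.
- exact: system_spatial S.
- by move=> t /H[].
- by move=> t /H[].
Qed.

Lemma velocity_split_integral t r : 0 <= t < T -> 0 <= r ->
  is_split_integral r (fun s => delta (gamma t s) (gamma t r) / rho t s * z0 s)
    (fun s => delta (gamma t r) (gamma t s) / rho t s * z0 s) (u t (gamma t r)).
Proof.
move=> tT r0; have [v [dv hv]] := sys_gamma_eq S tT r0.
have -> // : u t (gamma t r) = v.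
exact: has_deriv_within_unique (fun d d0 => itvco_limit_point tT d0) (hu tT r0) dv.
Qed.

(** The conservation law gamma^(n-1) rho^2 omega(t, gamma) = z0, solved for omega. *)
Definition transported_momentum t x :=
  z0 (eta t x) / (x ^+ n.-1 * rho t (eta t x) ^+ 2).

Lemma transported_momentum_gamma t r : 0 <= t < T -> 0 <= r ->
  transported_momentum t (gamma t r) = z0 r / (gamma t r ^+ n.-1 * rho t r ^+ 2).
Proof.
move=> tT r0; rewrite /transported_momentum.
by rewrite (inverse_flow_gamma (system_spatial S)).
Qed.

(** At time 0 the flow is the identity, and the equation for gamma_t is the
    integral formula for u0. *)
Lemma initial_velocity r : 0 < r -> u 0 r = u0 r.
Proof.
move=> r0; have zT : 0 <= (0 : R) < T by rewrite lexx.
have := velocity_split_integral zT (ltW r0).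
rewrite (sys_gamma_init S) ?(ltW r0)// => H.
have K := hu0 r0.
apply: (is_split_integral_inj _ K); apply: is_split_integral_eq H.
- move=> s /andP[s0 _]; rewrite (sys_gamma_init S) ?(ltW s0)//.
  by rewrite (sys_rho_init S) ?(ltW s0)// divr1.
- move=> s rs; have s0 := lt_trans r0 rs; rewrite (sys_gamma_init S) ?(ltW s0)//.
  by rewrite (sys_rho_init S) ?(ltW s0)// divr1.
Qed.

(** Substitute s = gamma(t, sigma) in the integral formula: since ds = rho dsigma,
    the measure s^(n-1) omega ds becomes z0 / rho dsigma, and the formula becomes
    the equation for gamma_t at sigma = eta t x. *)
Lemma transported_momentum_kernel t x : 0 <= t < T -> 0 < x ->
  kernel_formula n delta (transported_momentum t) x (u t x).
Proof.
move=> tT x0; have SF := system_spatial S.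
have [r0 rE] := inverse_flowP SF tT (ltW x0); set r := eta t x in r0 rE.
have rgt0 : 0 < r.
  rewrite lt_neqAle r0 andbT; apply/eqP => r00; move: x0.
  by rewrite -rE -r00 (sf_gamma0 SF tT) ltxx.
have [_ [a [b [/andP[a0 _] Hab]]]] := sys_phase S tT.
have Pa s : 0 <= s -> a <= rho t s by move=> /Hab/andP[].
have sub := @half_line_Rintegral R (gamma t) (rho t) (eta t) a
  (sf_gamma0 SF tT) (fun r hr => sf_rho SF tT hr) (fun r => sf_rho_cont SF tT)
  a0 Pa (fun x => inverse_flowP SF tT) (fun r => inverse_flow_gamma SF tT)
  (fun r => gamma_ge0 SF tT).
have eta_lt s : 0 < s -> (eta t s < r) = (s < x).
  move=> s0; have [es0 sE] := inverse_flowP SF tT (ltW s0).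
  by rewrite -(gamma_ltE SF tT es0 r0) sE rE.
have lt_eta s : 0 < s -> (r < eta t s) = (x < s).
  move=> s0; have [es0 sE] := inverse_flowP SF tT (ltW s0).
  by rewrite -(gamma_ltE SF tT r0 es0) sE rE.
have eta_gt0 s : 0 < s -> 0 < eta t s.
  move=> s0; have [es0 sE] := inverse_flowP SF tT (ltW s0).
  by rewrite -(gamma_ltE SF tT (lexx _) es0) sE (sf_gamma0 SF tT).
have := velocity_split_integral tT r0; rewrite rE.
move=> /is_split_integral_open[fi gi ->].
pose f s := delta (gamma t s) x / rho t s * z0 s.
pose g s := delta x (gamma t s) / rho t s * z0 s.
have rho0 s : 0 <= s -> 0 < rho t s by move=> /(sf_rho_gt0 SF tT).
have [fi' fE] :
    mu.-integrable `]0, x[ (EFin \o (fun s => f (eta t s) / rho t (eta t s))) /\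
    \int[mu]_(s in `]0, x[) (f (eta t s) / rho t (eta t s)) =
      \int[mu]_(s in `]0, r[) f s.
  apply: sub => //.
  - by move=> s; rewrite /= !in_itv/= andbT => /andP[].
  - move=> s; rewrite /= !in_itv/=; split => [/andP[s0 sx]|[s0 /andP[_]]].
      by rewrite s0 eta_gt0// eta_lt.
    by rewrite s0 eta_lt.
  - move=> s; rewrite /= in_itv/= => /andP[s0 sr].
    rewrite /f mulr_ge0_le0 ?(z0_le0 n homega0)//.
    rewrite divr_ge0 ?(ltW (rho0 _ (ltW s0)))//.
    apply/ltW/hdelta_pos; rewrite (gamma_gt0 SF)//= -rE ltW//.
    by apply: (gamma_lt SF) => //; exact: ltW.
have [gi' gE] :
    mu.-integrable `]x, +oo[ (EFin \o (fun s => g (eta t s) / rho t (eta t s))) /\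
    \int[mu]_(s in `]x, +oo[) (g (eta t s) / rho t (eta t s)) =
      \int[mu]_(s in `]r, +oo[) g s.
  apply: sub => //.
  - by move=> s; rewrite /= !in_itv/= !andbT; exact: lt_trans.
  - move=> s; rewrite /= !in_itv/= !andbT; split => [xs|[s0]].
      by rewrite (lt_trans x0 xs) lt_eta// (lt_trans x0 xs).
    by rewrite lt_eta.
  - move=> s; rewrite /= in_itv/= andbT => rs; have s0 := lt_trans rgt0 rs.
    rewrite /g mulr_ge0_le0 ?(z0_le0 n homega0)//.
    rewrite divr_ge0 ?(ltW (rho0 _ (ltW s0)))//.
    apply/ltW/hdelta_pos; rewrite x0/= -rE ltW//.
    exact: (gamma_lt SF).
rewrite -/f -/g -fE -gE.
have main : is_split_integral x (fun s => f (eta t s) / rho t (eta t s))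
    (fun s => g (eta t s) / rho t (eta t s))
    (\int[mu]_(s in `]0, x[) (f (eta t s) / rho t (eta t s)) +
     \int[mu]_(s in `]x, +oo[) (g (eta t s) / rho t (eta t s))).
  exact/is_split_integral_open.
apply: is_split_integral_eq main.
- move=> s /andP[s0 sx]; have [es0 sE] := inverse_flowP SF tT (ltW s0).
  rewrite /f /transported_momentum sE; field.
  by rewrite !gt_eqF ?exprn_gt0 ?rho0.
- move=> s xs; have s0 := lt_trans x0 xs.
  have [es0 sE] := inverse_flowP SF tT (ltW s0).
  rewrite /g /transported_momentum sE; field.
  by rewrite !gt_eqF ?exprn_gt0 ?rho0.
Qed.

(** Differentiate z0 / (gamma^(n-1) rho^2) in time, with gamma_t = u and
    rho_t / rho = u_r along the flow. *)
Lemma transported_momentum_equation (h : R -> R -> R)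
    (F : regular_flow T gamma rho h u) t r : 0 <= t < T -> 0 < r ->
  let du := velocity_gradient gamma rho h in
  has_deriv_within `[0, T[ (fun y => transported_momentum y (gamma y r)) t
    (- (2 * du t (gamma t r) * transported_momentum t (gamma t r) +
        n.-1%:R / gamma t r * u t (gamma t r) *
          transported_momentum t (gamma t r))).
Proof.
move=> tT r0 du; have SF := system_spatial S; have r0' := ltW r0.
have gt0 := gamma_gt0 SF tT r0; have rt0 := sf_rho_gt0 SF tT r0'.
have rI : `[0, +oo[%classic r by rewrite /= in_itv/= r0'.
have drho := uniform_quotient_has_deriv (rf_quot F tT) rI.
have nz : gamma t r ^+ n.-1 * rho t r ^+ 2 != 0.
  by rewrite mulf_neq0 ?expf_neq0// gt_eqF.
have M := has_deriv_withinM (has_deriv_withinX (k := n.-1) (hu tT r0'))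
  (has_deriv_withinX (k := 2) drho).
have H := has_deriv_withinM (has_deriv_within_cst `[0, T[ (z0 r) t) 
  (has_deriv_withinV (f := fun y => gamma y r ^+ n.-1 * rho y r ^+ 2) nz M).
apply: (@has_deriv_within_eq _ _
  (fun y => z0 r * (gamma y r ^+ n.-1 * rho y r ^+ 2)^-1)).
- by rewrite /= in_itv.
- by move=> y; rewrite inE/= in_itv/= => yT; rewrite transported_momentum_gamma.
rewrite [X in has_deriv_within _ _ _ X](_ : _ =
  0 * (gamma t r ^+ n.-1 * rho t r ^+ 2)^-1 +
  z0 r * (- (n.-1%:R * gamma t r ^+ n.-1.-1 * u t (gamma t r) * rho t r ^+ 2 +
    gamma t r ^+ n.-1 * (2%:R * rho t r ^+ 1 * h t r)) /
    (gamma t r ^+ n.-1 * rho t r ^+ 2) ^+ 2)); first exact: H.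
rewrite transported_momentum_gamma// /du /velocity_gradient (inverse_flow_gamma SF)//.
have g0 : gamma t r != 0 by rewrite gt_eqF.
have p0 : rho t r != 0 by rewrite gt_eqF.
case: n.-1 => [|k].
  by rewrite !expr0; field; rewrite ?g0 ?p0.
have gk : gamma t r ^+ k != 0 by rewrite expf_neq0.
by rewrite (exprS _ k) /=; field; rewrite ?g0 ?p0 ?gk.
Qed.

Lemma flow_velocity_C1_solution : C1_solution n delta u0 omega0 `[0, T[ u.
Proof.
have [h F] := system_regular_flow; have SF := system_spatial S.
exists (velocity_gradient gamma rho h), transported_momentum, gamma; split.
- exact: velocity_continuous F.
- exact: velocity_gradient_continuous F.
- by move=> t r; rewrite /= in_itv/= => tT r0; exact: (velocity_has_deriv F).
- exact: initial_velocity.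
- move=> r r0; have zT : 0 <= (0 : R) < T by rewrite lexx.
  have := transported_momentum_gamma zT (ltW r0).
  rewrite (sys_gamma_init S) ?(ltW r0)// => ->.
  rewrite (sys_rho_init S) ?(ltW r0)// expr1n mulr1 /momentum_density.
  by rewrite mulrC mulKf// expf_neq0// gt_eqF.
- by move=> t r; rewrite /= in_itv/=; exact: transported_momentum_kernel.
- exact: sys_gamma_init S.
- by move=> t r; rewrite /= in_itv/= => tT r0; exact: (gamma_ge0 SF).
- by move=> t r; rewrite /= in_itv/=; exact: hu.
- by move=> t r; rewrite /= in_itv/= => tT r0; exact: transported_momentum_equation.
Qed.

End classical_solution.

(** * Blow-up of the velocity gradient *)

Section blow_up.
Context {R : realType}.

(** If |d| <= M near T, then f e^(M t) is nondecreasing there, and f cannot tend to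
    zero. *)
Lemma log_derivative_unbounded (T : R) (f d : R -> R) : 0 < T ->
  (forall t, 0 <= t < T -> 0 < f t) ->
  (forall t, 0 <= t < T -> has_deriv_within `[0, T[ f t (f t * d t)) ->
  f t @[t --> T^'-] --> (0 : R) ->
  forall M t0, t0 < T -> exists2 t, t0 < t < T /\ 0 <= t & M < `|d t|.
Proof.
move=> T0 f0 df fT M0 t0 t0T; apply: contrapT => noM.
pose M := `|M0|; have M00 : 0 <= M by rewrite normr_ge0.
have bd t : t0 < t < T -> 0 <= t -> `|d t| <= M.
  move=> tT t0'; rewrite leNgt; apply/negP => Md; apply: noM; exists t => //.
  by apply: le_lt_trans Md; exact: ler_norm.
pose t1 := Num.max 0 ((t0 + T) / 2).
have t10 : 0 <= t1 by rewrite le_max lexx.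
have t1T : t1 < T by rewrite gt_max T0/=; lra.
have t01 : t0 < t1 by rewrite lt_max; apply/orP; right; lra.
have lower t : t1 <= t -> t < T -> f t1 * expR (- (M * (T - t1))) <= f t.
  move=> t1t tT.
  pose D := `[0, T[%classic : set R.
  have dE y : has_deriv_within D (fun y => expR (M * y)) y (expR (M * y) * M).
    have idE : has_deriv_within D id y 1.
      by apply: is_derive_has_deriv_within; exact: is_derive_id.
    have := has_deriv_within_comp (D' := setT) (fun _ _ => I)
      (has_deriv_withinM (has_deriv_within_cst D M y) idE)
      (is_derive_has_deriv_within setT (is_derive_expR (M * y))).
    by rewrite mul0r add0r mulr1.
  have [| |c /andP[c1 ct] E] := @mean_value_within _ D (fun y => f y * expR (M * y))
      (fun y => f y * d y * expR (M * y) + f y * (expR (M * y) * M)) t1 t _ t1t.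
  - move=> y; rewrite /D/= !in_itv/= => /andP[t1y yt].
    by rewrite (le_trans t10)//= (le_lt_trans yt).
  - move=> y /andP[t1y yt]; apply: has_deriv_withinM => //; apply: df.
    by rewrite (le_trans t10)//= (le_lt_trans yt).
  have cT : 0 <= c < T by rewrite (le_trans t10)//= (le_lt_trans ct).
  have dc : `|d c| <= M.
    by apply: bd; [rewrite (lt_le_trans t01)//= (le_lt_trans ct)|case/andP: cT].
  have : 0 <= f t * expR (M * t) - f t1 * expR (M * t1).
    rewrite E mulr_ge0 ?subr_ge0//.
    rewrite (_ : _ + _ = f c * expR (M * c) * (d c + M)); last by ring.
    rewrite !mulr_ge0 ?(ltW (f0 c cT)) ?expR_ge0//.
    by move: dc; rewrite ler_norml => /andP[]; lra.
  rewrite subr_ge0 => H.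
  rewrite -(ler_pM2r (expR_gt0 (M * t))); apply: le_trans H.
  rewrite -mulrA -expRD ler_wpM2l ?(ltW (f0 _ _)) ?t10//.
  rewrite ler_expR; have : M * t <= M * T by rewrite ler_wpM2l// ltW.
  by rewrite mulrBr; lra.
pose c := f t1 * expR (- (M * (T - t1))).
have c0 : 0 < c by rewrite mulr_gt0 ?expR_gt0// f0// t10.
move/cvgrPdist_lt : fT => /(_ _ c0)[e /= e0 He].
pose t := Num.max t1 (T - e / 2).
have tT : t < T by rewrite gt_max t1T/=; lra.
have t1t : t1 <= t by rewrite le_max lexx.
have te : T - e / 2 <= t by rewrite le_max lexx orbT.
have := He t; rewrite /= sub0r normrN => /(_ _ tT).
have tTe : `|T - t| < e by rewrite gtr0_norm ?subr_gt0//; lra.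
move=> /(_ tTe); rewrite gtr0_norm; last by rewrite f0// (le_trans t10).
by rewrite ltNge lower.
Qed.

Section flow.
Variables (T : R) (gamma rho h u : R -> R -> R) (r : R).
Hypotheses (T0 : 0 < T) (r0 : 0 <= r) (F : regular_flow T gamma rho h u)
  (rhoT : rho t r @[t --> T^'-] --> (0 : R)).

Lemma velocity_gradient_unbounded M t0 : t0 < T ->
  exists2 t, t0 < t < T /\ 0 <= t &
    M < `|velocity_gradient gamma rho h t (gamma t r)|.
Proof.
move=> t0T.
pose d t := velocity_gradient gamma rho h t (gamma t r).
apply: (@log_derivative_unbounded T (rho^~ r) d) => //.
- by move=> t tT; exact: (sf_rho_gt0 F).
- move=> t tT; rewrite /d /velocity_gradient (inverse_flow_gamma F)//.
  rewrite mulrC divfK ?gt_eqF ?(sf_rho_gt0 F)//.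
  apply: uniform_quotient_has_deriv (rf_quot F tT) _.
  by rewrite /= in_itv/= r0.
Qed.

Lemma velocity_C1_norm_blows_up : C1_norm_blows_up T u.
Proof.
move=> M t0 t0T; have [t [tT t00] Mt] := velocity_gradient_unbounded M t0T.
have tT' : 0 <= t < T by rewrite t00; case/andP: tT.
exists t, (gamma t r), (velocity_gradient gamma rho h t (gamma t r)); split => //.
- exact: (gamma_ge0 F).
- by apply: (velocity_has_deriv F) => //; exact: (gamma_ge0 F).
- by apply: lt_le_trans Mt _; rewrite lerDr.
Qed.

(** The trajectory of r is nonincreasing and nonnegative, so it converges. At time
    T and at its limit, dv would be continuous, hence bounded along the end of the
    trajectory, where it agrees with the unbounded gradient of u. *)
Lemma velocity_not_extendable (v dv : R -> R -> R) :
  (forall t' t, 0 <= t' -> t' <= t -> t < T -> gamma t r <= gamma t' r) ->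
  {within `[0, T] `*` `[0, +oo[, continuous (fun p : R * R => dv p.1 p.2)} ->
  (forall t x, `[0, T]%classic t -> 0 <= x ->
    has_deriv_within `[0, +oo[ (v t) x (dv t x)) ->
  (forall t x, 0 <= t < T -> 0 <= x -> v t x = u t x) -> False.
Proof.
move=> gd cdv dvE vu.
pose I := [set gamma t r | t in `[0, T[%classic].
have hI : has_inf I.
  split; first by exists (gamma 0 r), 0 => //; rewrite /= in_itv/= lexx.
  by exists 0 => _ [t /= + <-]; rewrite in_itv/= => tT; exact: (gamma_ge0 F).
have L0 : 0 <= inf I.
  apply: lb_le_inf; first exact: hI.1.
  by move=> _ [t /= + <-]; rewrite in_itv/= => tT; exact: (gamma_ge0 F).
have TT : `[0, T]%classic T by rewrite /= in_itv/= lexx ltW.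
have LI : `[0, +oo[%classic (inf I) by rewrite /= in_itv/= L0.
have /joint_continuousP/(_ T (inf I) TT LI)/joint_cvgP/(_ 1 ltr01)[d d0 Hd] := cdv.
have [_ [t1 /= + <-] t1d] := inf_adherent d0 hI; rewrite in_itv/= => /andP[t10 t1T].
have [|t [/andP[tl tT] t00]] :=
  @velocity_gradient_unbounded (`|dv T (inf I)| + 1) (Num.max t1 (T - d)).
  by rewrite gt_max t1T/=; lra.
have tT' : 0 <= t < T by rewrite t00.
move: tl; rewrite gt_max => /andP[t1t Tdt].
have g0 : 0 <= gamma t r by exact: (gamma_ge0 F).
have tI : `[0, T]%classic t by rewrite /= in_itv/= t00 ltW.
have dvu : dv t (gamma t r) = velocity_gradient gamma rho h t (gamma t r).
  apply: (has_deriv_within_unique (fun d d0 => itvcy_limit_point g0 d0)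
    (dvE _ _ tI g0)).
  have gI : `[0, +oo[%classic (gamma t r) by rewrite /= in_itv/= g0.
  apply: has_deriv_within_eq (velocity_has_deriv F tT' g0) => //.
  by move=> y; rewrite inE/= in_itv/= andbT => y0; rewrite vu.
rewrite -dvu ltNge => /negP; apply.
have infg : inf I <= gamma t r.
  by apply: ge_inf; [exact: hI.2|exists t => //; rewrite /= in_itv/= t00].
have gI : `[0, +oo[%classic (gamma t r) by rewrite /= in_itv/= g0.
have := Hd t (gamma t r) tI gI.
have tTd : `|t - T| < d by rewrite ltr0_norm ?subr_lt0//; lra.
have gLd : `|gamma t r - inf I| < d.
  rewrite ger0_norm ?subr_ge0//; have := gd _ _ t10 (ltW t1t) tT; lra.
move=> /(_ tTd gLd) H.
have := ler_normD (dv t (gamma t r) - dv T (inf I)) (dv T (inf I)).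
rewrite subrK; lra.
Qed.

End flow.

End blow_up.

(** * Collapse of the stretch *)

Section stretch_limit.
Context {R : realType}.

Lemma nonincreasing_cvg0 (T : R) (f : R -> R) : 0 < T ->
  (forall t, 0 <= t < T -> 0 < f t) ->
  (forall t' t, 0 <= t' -> t' <= t -> t < T -> f t <= f t') ->
  (forall c, 0 < c -> exists2 t, 0 <= t < T & f t < c) ->
  f t @[t --> T^'-] --> (0 : R).
Proof.
move=> T0 f0 fd fc; apply/cvgrPdist_lt => e e0.
have [t /andP[t0 tT] ft] := fc e e0.
exists (T - t) => /=; first by rewrite subr_gt0.
move=> y /= yT' yT.
have ty : t < y by move: yT'; rewrite ltr_norml => /andP[_]; lra.
rewrite sub0r normrN gtr0_norm; last by apply: f0; rewrite (ltW (le_lt_trans t0 ty)).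
by apply: le_lt_trans ft; apply: fd => //; exact: ltW.
Qed.

End stretch_limit.
Section stretch_vanishes.
Context {R : realType}.
Variables (n : nat) (delta : R -> R -> R) (omega0 Q dQ : R -> R) (C : R).
Hypotheses (homega0 : forall r, 0 < r -> omega0 r <= 0)
  (hdelta_pos : forall r s, 0 < r <= s -> 0 < delta r s)
  (hQ_pos : forall r, 0 <= r -> 0 < Q r)
  (hQ : forall r, 0 <= r -> has_deriv_within `[0, +oo[ Q r (dQ r))
  (hC : 0 < C)
  (hcond1 : forall r s, 0 <= s < r -> wedge (s, r) ->
       0 <= dQ r / Q r * delta s r + partial2 delta s r)
  (hcond2 : forall r s, 0 <= r <= s -> wedge (r, s) ->
       C / Q s <= dQ r / Q r * delta r s + partial1 delta r s)
  (mz0 : measurable_fun `](0 : R), +oo[ (momentum_density n omega0)).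
Variables (T : R) (gamma rho : R -> R -> R).
Hypotheses (T0 : 0 < T) (S : system_solution n delta omega0 T gamma rho).

(** Only Q(gamma) rho is monotone in time; the factor Q(gamma) is harmless as
    gamma stays between 0 and its initial value. *)
Lemma stretch_vanishes (r : R) : 0 <= r ->
  (forall c, 0 < c -> exists2 t, 0 <= t < T & rho t r < c) ->
  rho t r @[t --> T^'-] --> (0 : R).
Proof.
move=> r0 small; have SF := system_spatial S.
have zT : 0 <= (0 : R) < T by rewrite lexx.
have Qc : {within `[0, r], continuous Q}.
  apply/subspace_continuousP => x /=; rewrite in_itv/= => /andP[x0 _].
  apply: (@has_deriv_within_cont _ _ _ _ (dQ x)).
  apply: has_deriv_within_subset (hQ x0) => y /=.
  by rewrite !in_itv/= andbT => /andP[].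
have [x1 x1I Qmax] := EVT_max r0 Qc.
have [x2 x2I Qmin] := EVT_min r0 Qc.
have gI t : 0 <= t < T -> gamma t r \in `[0, r].
  move=> tT; rewrite in_itv/= (gamma_ge0 SF)//=.
  have [t0 tT'] := andP tT.
  have := gamma_nonincreasing homega0 hdelta_pos S (lexx 0) t0 tT' r0.
  by rewrite (sys_gamma_init S).
have Q1 : 0 < Q x1 by apply: hQ_pos; move: x1I; rewrite in_itv/= => /andP[].
have Q2 : 0 < Q x2 by apply: hQ_pos; move: x2I; rewrite in_itv/= => /andP[].
pose f t := Q (gamma t r) * rho t r.
have f0 t : 0 <= t < T -> 0 < f t.
  by move=> tT; rewrite mulr_gt0 ?(sf_rho_gt0 SF)// hQ_pos// (gamma_ge0 SF).
have fT : f t @[t --> T^'-] --> (0 : R).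
  apply: nonincreasing_cvg0 => //.
  - move=> t' t t'0 t't tT; rewrite -lef_pV2 ?posrE ?f0//.
    + exact: (weight_le homega0 hQ_pos hQ hC hcond1 hcond2 mz0 S).
    + by rewrite t'0 (le_lt_trans t't).
    + by rewrite tT (le_trans t'0).
  - move=> c c0; have [|t tT tc] := small (c / Q x1); first by rewrite divr_gt0.
    exists t => //; rewrite ltr_pdivlMr// mulrC in tc; apply: le_lt_trans tc.
    by rewrite ler_wpM2r ?(ltW (sf_rho_gt0 SF _ _))// Qmax// gI.
apply/cvgrPdist_lt => e e0; move/cvgrPdist_lt : fT => /(_ (e * Q x2)).
rewrite mulr_gt0// => /(_ isT)[d /= d0 Hd].
exists (Num.min d T) => /=; first by rewrite lt_min d0.
move=> t /=; rewrite lt_min => /andP[td tT'] tT.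
have tT0 : 0 <= t < T.
  by rewrite tT andbT; move: tT'; rewrite ltr_norml => /andP[_]; lra.
have := Hd t td tT; rewrite !sub0r !normrN (gtr0_norm (f0 t tT0)) => H.
have rt0 := sf_rho_gt0 SF tT0 r0.
rewrite gtr0_norm// -(ltr_pM2l Q2) (mulrC _ e); apply: le_lt_trans H.
by rewrite ler_wpM2r ?(ltW rt0)// Qmin// gI.
Qed.

End stretch_vanishes.

Theorem theorem7 (R : realType) (n : nat) (hn : (0 < n)%N)
    (E F : set (vfield R n)) (A : vfield R n -> vfield R n)
    (hA : invertible_inertia_operator E F A)
    (hrad : preserves_radial E A)
    (u0 omega0 : R -> R)
    (hu0 : E (radial u0))
    (hAu0 : A (radial u0) = radial omega0)
    (hu0_neq0 : exists2 r, 0 < r & u0 r <> 0)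
    (homega0 : forall r, 0 < r -> omega0 r <= 0)
    (delta : R -> R -> R)
    (hdelta_smooth : smooth_on (@wedge R) delta)
    (hdelta_pos : forall r s, 0 < r <= s -> 0 < delta r s)
    (hdelta : forall u omega : R -> R,
       E (radial u) -> A (radial u) = radial omega ->
       forall r, 0 < r -> kernel_formula n delta omega r (u r))
    (Q dQ : R -> R) (C : R)
    (hQ_pos : forall r, 0 <= r -> 0 < Q r)
    (hQ : forall r, 0 <= r -> has_deriv_within `[0, +oo[ Q r (dQ r))
    (hC : 0 < C)
    (hcond1 : forall r s, 0 <= s < r -> wedge (s, r) ->
       0 <= dQ r / Q r * delta s r + partial2 delta s r)
    (hcond2 : forall r s, 0 <= r <= s -> wedge (r, s) ->
       C / Q s <= dQ r / Q r * delta r s + partial1 delta r s)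
    (T0 : R) (gamma0 rho0 : R -> R -> R)
    (hT0 : 0 < T0)
    (hlocal : system_solution n delta omega0 T0 gamma0 rho0)
    (hcontinue : continues_while_positive n delta omega0) :
  exists (T : R) (gamma rho : R -> R -> R),
    [/\ T0 <= T,
        system_solution n delta omega0 T gamma rho,
        extends T0 gamma0 rho0 gamma rho,
        (exists2 r, 0 <= r & rho t r @[t --> T^'-] --> (0 : R)) &
        forall u : R -> R -> R,
          (forall t r, 0 <= t < T -> 0 <= r ->
             has_deriv_within `[0, T[ (gamma^~ r) t (u t (gamma t r))) ->
          [/\ C1_solution n delta u0 omega0 `[0, T[ u,
              C1_norm_blows_up T u &
              ~ exists v : R -> R -> R,
                  C1_solution n delta u0 omega0 `[0, T] v /\
                  forall t r, 0 <= t < T -> 0 <= r -> v t r = u t r]].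
Proof.
have hk := hdelta u0 omega0 hu0 hAu0.
have mz0 := measurable_momentum_density hdelta_smooth hdelta_pos hk.
pose m0 := \int[@lebesgue_measure R]_(s in `](0 : R), +oo[)
  (- momentum_density n omega0 s / Q s).
have initE T gamma rho s : 0 < T -> system_solution n delta omega0 T gamma rho ->
    0 < s -> weight Q gamma rho 0 s = (Q s)^-1.
  move=> T1 S s0; rewrite /weight (sys_gamma_init S) ?(ltW s0)//.
  by rewrite (sys_rho_init S) ?(ltW s0)// mulr1.
have zT T : 0 < T -> 0 <= (0 : R) < T by rewrite lexx.
have m0_gt0 : 0 < m0.
  apply: (momentum_density_neq0 hk hu0_neq0).
  - move=> s s0; rewrite divr_ge0 ?(ltW (hQ_pos _ (ltW s0)))//.
    by rewrite oppr_ge0 z0_le0.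
  - move=> s s0 /eqP; rewrite mulf_eq0 invr_eq0 (gt_eqF (hQ_pos _ (ltW s0))) orbF.
    by rewrite oppr_eq0 => /eqP.
  - apply: eq_integrable (mass_density_integrable homega0 hQ_pos hQ hC hcond1
      hcond2 mz0 hlocal (zT _ hT0) (lexx 0)) => // s.
    by rewrite inE/= in_itv/= andbT => s0; rewrite (initE _ _ _ _ hT0 hlocal).
have bound T gamma rho : 0 < T -> system_solution n delta omega0 T gamma rho ->
    T <= 2 / (C / 2 * m0).
  move=> T1 S.
  have massE : mass n omega0 Q gamma rho 0 0 = m0.
    apply: eq_Rintegral => s; rewrite inE/= in_itv/= andbT => s0.
    by rewrite (initE _ _ _ _ T1 S).
  rewrite -massE.
  apply: (system_time_bound homega0 hQ_pos hQ hC hcond1 hcond2 mz0 S).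
  by rewrite massE.
have [T [gamma [rho [T0T S ext max]]]] := maximal_solution_exists bound hT0 hlocal.
have T1 : 0 < T := lt_le_trans hT0 T0T.
have [r r0 small] : exists2 r, 0 <= r &
    forall c, 0 < c -> exists2 t, 0 <= t < T & rho t r < c.
  apply: contrapT => noR.
  have [|T' [gamma' [rho' [TT' S' ext']]]] := hcontinue T gamma rho T1 S; last first.
    exact: max TT' S' ext'.
  move=> r r0; apply: contrapT => noc; apply: noR; exists r => // c c0.
  apply: contrapT => not; apply: noc; exists c => // t tT.
  by rewrite leNgt; apply/negP => tc; apply: not; exists t.
have rhoT := stretch_vanishes homega0 hdelta_pos hQ_pos hQ hC hcond1 hcond2
  mz0 T1 S r0 small.
exists T, gamma, rho; split => //; first by exists r.
move=> u hu; have [h RF] := system_regular_flow S hu.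
split.
- exact: (flow_velocity_C1_solution homega0 hdelta_pos hk T1 S hu).
- exact: (velocity_C1_norm_blows_up T1 r0 RF rhoT).
- move=> [v [[dv [omega [g V]]] vu]].
  apply: (velocity_not_extendable T1 r0 RF rhoT (v := v) (dv := dv)) => //.
  + move=> t' t t'0 t't tT.
    exact: (gamma_nonincreasing homega0 hdelta_pos S).
  + exact: epd_du_cont V.
  + by move=> t x tI x0; exact: (epd_du V).
Qed.
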